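(* Let $G$ be a finite simple connected graph which is complete intersection. Then exactly one of the following holds: (1) all blocks of $G$ are bipartite; (2) all blocks of $G$ are bipartite except one; (3) all blocks of $G$ are bipartite except two, and these two blocks are contiguous.
   Context: For a finite simple graph $G$ with edges $e_1,\dots,e_m$ and a field $K$, the toric ideal $I_G\subseteq K[e_1,\dots,e_m]$ is the kernel of the $K$-algebra map $e_i=\{v_j,v_k\}\mapsto v_jv_k$; $G$ is complete intersection if $I_G$ is generated by $\operatorname{ht}(I_G)$ elements. A block of $G$ is a maximal connected subgraph without cut vertex (a maximal biconnected subgraph). Two blocks of $G$ are called contiguous if there is a path from one to the other in which each edge of the path belongs to a different block of $G$. *)

(* Defs.v *)
From HB Require Import structures.
From mathcomp Require Import all_boot all_order all_algebra.
Set Implicit Arguments. Unset Strict Implicit. Unset Printing Implicit Defensive.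
Import GRing.Theory.
Local Open Scope ring_scope.

(* Multivariate polynomial rings R[x_0, ..., x_{n-1}], built as        *)
(* iterated univariate polynomial rings: mpoly R 0 = R,                *)
(* mpoly R n.+1 = {poly mpoly R n}; the outermost 'X is x_0.           *)
Fixpoint mpoly (R : comNzRingType) (n : nat) : comNzRingType :=
  match n with
  | 0 => R
  | n'.+1 => ({poly mpoly R n'} : comNzRingType)
  end.

(* the variable x_i (and 0 if i >= n) *)
Fixpoint mvar (R : comNzRingType) (n i : nat) {struct n} : mpoly R n :=
  match n return mpoly R n with
  | 0 => 0
  | n'.+1 => match i with
             | 0 => ('X : {poly mpoly R n'})
             | i'.+1 => ((mvar R n' i')%:P : {poly mpoly R n'})
             end
  end.

Fixpoint mconst (R : comNzRingType) (n : nat) : R -> mpoly R n :=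
  match n return R -> mpoly R n with
  | 0 => fun c => c
  | n'.+1 => fun c => ((mconst n' c)%:P : {poly mpoly R n'})
  end.

Fixpoint meval (R S : comNzRingType) (f : R -> S) (n : nat) (a : nat -> S)
  {struct n} : mpoly R n -> S :=
  match n return mpoly R n -> S with
  | 0 => f
  | n'.+1 => fun p : {poly mpoly R n'} =>
      \sum_(i < size p) meval f (fun j => a j.+1) p`_i * a 0%N ^+ i
  end.

Definition is_ideal (R : comNzRingType) (I : R -> Prop) : Prop :=
  [/\ I 0, (forall x y, I x -> I y -> I (x + y)) & (forall r x, I x -> I (r * x))].

Definition is_prime_ideal (R : comNzRingType) (P : R -> Prop) : Prop :=
  [/\ is_ideal P, ~ P 1 & (forall x y, P (x * y) -> P x \/ P y)].

Definition generated_by (R : comNzRingType) (I : R -> Prop) (k : nat) : Prop :=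
  exists g : k.-tuple R,
    forall x, I x <-> exists c : k.-tuple R, x = \sum_(i < k) tnth c i * tnth g i.

Definition prime_chain_to (R : comNzRingType) (P : R -> Prop) (k : nat) : Prop :=
  exists Q : nat -> R -> Prop,
    [/\ forall i, (i <= k)%N -> is_prime_ideal (Q i),
        forall i, (i < k)%N -> (forall x, Q i x -> Q i.+1 x) /\
                                (exists x, Q i.+1 x /\ ~ Q i x)
      & forall x, Q k x <-> P x].

(* ht(I) = h : the minimum over the primes P containing I of ht(P) is h,
   where ht(P) is the supremum of lengths of prime chains ending at P. *)
Definition ideal_height (R : comNzRingType) (I : R -> Prop) (h : nat) : Prop :=
  (forall P, is_prime_ideal P -> (forall x, I x -> P x) -> prime_chain_to P h) /\
  (exists P, [/\ is_prime_ideal P, (forall x, I x -> P x) & ~ prime_chain_to P h.+1]).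

(* Finite simple graphs: e : rel T symmetric and irreflexive.          *)
Section Graph.
Variables (T : finType) (e : rel T).

Definition edges : seq (T * T) :=
  [seq xy <- [seq (x, y) | x <- enum T, y <- enum T] |
     e xy.1 xy.2 && (enum_rank xy.1 < enum_rank xy.2)%N].

Definition nedges : nat := size edges.

(* the K-algebra map K[e_1..e_m] -> K[v_1..v_n], e_i = {x,y} |-> v_x v_y,
   where vertex v is the variable with index enum_rank v *)
Definition toric_map (K : fieldType) : mpoly K nedges -> mpoly K #|T| :=
  meval (@mconst K #|T|)
        (fun i => nth 0 [seq mvar K #|T| (enum_rank xy.1) * mvar K #|T| (enum_rank xy.2)
                        | xy <- edges] i).

Definition toric_ideal (K : fieldType) : mpoly K nedges -> Prop :=
  fun p => toric_map (K:=K) p = 0.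

Definition complete_intersection (K : fieldType) : Prop :=
  exists h, ideal_height (@toric_ideal K) h /\ generated_by (@toric_ideal K) h.

End Graph.

(* Blocks of a graph.  Subgraphs are given by their vertex set B (a    *)
(* maximal connected subgraph without cut vertex is necessarily an     *)
(* induced subgraph, so blocks are determined by their vertex sets).   *)
Section Blocks.
Variables (T : finType) (e : rel T).

Definition induced_rel (B : {set T}) : rel T :=
  fun x y => [&& e x y, x \in B & y \in B].

Definition induced_connected (B : {set T}) : bool :=
  (B != set0) && [forall x in B, forall y in B, connect (induced_rel B) x y].

Definition cut_vertex (B : {set T}) (v : T) : bool :=
  (v \in B) &&
  [exists x in B :\ v, exists y in B :\ v, ~~ connect (induced_rel (B :\ v)) x y].

Definition conn_nocut (B : {set T}) : bool :=
  induced_connected B && [forall v, ~~ cut_vertex B v].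

Definition is_block (B : {set T}) : bool :=
  conn_nocut B && [forall B' : {set T}, (B \subset B') && conn_nocut B' ==> (B' == B)].

Definition bipartite_on (B : {set T}) : bool :=
  [exists c : {ffun T -> bool}, forall x in B, forall y in B, e x y ==> (c x != c y)].

Definition edge_in (B : {set T}) (x y : T) : bool := [&& e x y, x \in B & y \in B].

Definition contiguous (B1 B2 : {set T}) : Prop :=
  exists (x : T) (s : seq T),
    [/\ x \in B1, last x s \in B2, path e x s, uniq (x :: s) &
        forall i j, (i < size s)%N -> (j < size s)%N -> i != j ->
          forall B, is_block B ->
            ~~ (edge_in B (nth x (x :: s) i) (nth x (x :: s) i.+1) &&
                edge_in B (nth x (x :: s) j) (nth x (x :: s) j.+1))].

Definition nonbip_blocks : {set {set T}} :=
  [set B : {set T} | is_block B && ~~ bipartite_on B].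
End Blocks.

(* Main.v *)
Require Import Defs.
From HB Require Import structures.
From mathcomp Require Import all_boot all_order all_algebra.
From mathcomp Require Import zify.
From Stdlib Require Import ClassicalEpsilon.
Set Implicit Arguments. Unset Strict Implicit. Unset Printing Implicit Defensive.
Import GRing.Theory.

(** Let G be connected and non-bipartite with n vertices and m edges, and let L be the
    kernel of the incidence map Z^m -> Z^n.  A chain of primes of length h ending at I_G
    can be traded for algebraically independent elements, so h <= m - n.  If h elements
    generate I_G, then so do at most h binomials: a longer list of binomials is dependent
    modulo the irrelevant ideal, and the grading lets one of them be dropped.  For every
    vertex set S, the exponent vectors of those binomials that live on S span
    L_S mod 2, where L_S consists of the vectors of L supported on edges inside S; as
    L mod 2 has dimension at least m - n, all of them together are independent over F_2.
    Hence the family L_S mod 2 is distributive: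
    L_S meets L_S1 + L_S2 in the sum of the L_(S cap Si).

    A non-bipartite connected set S and c in S carry a vector q with boundary 2c, whose
    coordinates sum to 1, whereas vectors of L have sum 0.  For odd sets S1, S2 attached at
    c1, c2, the class of q1 + q2 mod 2 lies in L of S1, S2 and any connection between them.
    Two connections without a common one, or a third odd set D through which S1 and S2
    are connected, then contradict distributivity by a parity count.  Blocks provide such
    configurations because everything outside a block hangs off it at a single vertex. *)

(** * Iterated polynomial rings *)

Section Evaluation.
Local Open Scope ring_scope.
Variables (R S : comNzRingType) (f : {rmorphism R -> S}).

(** Each layer is a Horner evaluation at [a 0] over the evaluation of the coefficients, so the ring
    morphism structure comes from [horner_morph]. *)
Lemma meval_rmorph (n : nat) (a : nat -> S) :
  exists g : {rmorphism mpoly R n -> S}, g =1 meval f a.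
Proof.
elim: n a => [|n IHn] a; first by exists f.
have [g gE] := IHn (fun j => a j.+1).
have cga : commr_rmorph g (a 0%N) by move=> x; apply: mulrC.
exists (horner_morph cga) => p /=.
rewrite /horner_morph /map_poly horner_poly.
by apply: eq_bigr => i _; rewrite gE.
Qed.

Lemma meval_is_zmod_morphism (n : nat) (a : nat -> S) :
  zmod_morphism (meval f (n := n) a).
Proof. by have [g gE] := meval_rmorph n a => x y; rewrite -!gE rmorphB. Qed.

Lemma meval_is_monoid_morphism (n : nat) (a : nat -> S) :
  monoid_morphism (meval f (n := n) a).
Proof.
have [g gE] := meval_rmorph n a.
by split=> [|x y]; rewrite -!gE ?rmorph1 ?rmorphM.
Qed.

HB.instance Definition _ n a := GRing.isZmodMorphism.Build
  (mpoly R n) S (meval f (n := n) a) (@meval_is_zmod_morphism n a).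
HB.instance Definition _ n a := GRing.isMonoidMorphism.Build
  (mpoly R n) S (meval f (n := n) a) (@meval_is_monoid_morphism n a).

Lemma mevalS (n : nat) (a : nat -> S) (p : mpoly R n.+1) :
  meval f a p = \sum_(i < size (p : {poly mpoly R n}))
    meval f (fun j => a j.+1) (p : {poly mpoly R n})`_i * a 0%N ^+ i.
Proof. by []. Qed.

Lemma mevalC (n : nat) (a : nat -> S) (c : mpoly R n) :
  meval f (n := n.+1) a (c%:P : {poly mpoly R n}) = meval f (fun j => a j.+1) c.
Proof.
rewrite mevalS size_polyC; case: eqVneq => [->|_]; first by rewrite big_ord0 rmorph0.
by rewrite big_ord1 coefC mulr1.
Qed.

Lemma mevalX (n : nat) (a : nat -> S) :
  meval f (n := n.+1) a ('X : {poly mpoly R n}) = a 0%N.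
Proof.
by rewrite mevalS size_polyX !big_ord_recl big_ord0 !coefX rmorph0 rmorph1
  mul0r mul1r add0r addr0.
Qed.

Lemma meval_mvar (n i : nat) (a : nat -> S) :
  (i < n)%N -> meval f a (mvar R n i) = a i.
Proof.
elim: n i a => [|n IHn] [|i] a // lt_in; first exact: mevalX.
exact: etrans (mevalC _ _) (IHn _ _ lt_in).
Qed.

Lemma meval_mconst (n : nat) (a : nat -> S) (c : R) :
  meval f a (mconst n c) = f c.
Proof.
by elim: n a => [|n IHn] a //; apply: etrans (mevalC _ _) (IHn _).
Qed.
End Evaluation.

(** * Monomials, coefficient functionals and bounds on exponents *)

Section Monomials.
Local Open Scope ring_scope.
Variable K : comNzRingType.

Lemma mconst_is_zmod_morphism n : zmod_morphism (@mconst K n).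
Proof. by elim: n => [|n IHn] x y //=; rewrite IHn polyCB. Qed.

Lemma mconst_is_monoid_morphism n : monoid_morphism (@mconst K n).
Proof.
elim: n => [|n [IH1 IHM]] //=.
by split=> [|x y] /=; rewrite ?IH1 ?IHM ?polyCM.
Qed.

HB.instance Definition _ n := GRing.isZmodMorphism.Build
  K (mpoly K n) (@mconst K n) (@mconst_is_zmod_morphism n).
HB.instance Definition _ n := GRing.isMonoidMorphism.Build
  K (mpoly K n) (@mconst K n) (@mconst_is_monoid_morphism n).

Definition mmon (n : nat) (a : nat -> nat) : mpoly K n :=
  \prod_(i < n) mvar K n i ^+ a i.

Lemma mmon0 (a : nat -> nat) : mmon 0 a = 1.
Proof. exact: big_ord0. Qed.

Lemma mmonS (n : nat) (a : nat -> nat) :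
  mmon n.+1 a = ((mmon n (fun i => a i.+1))%:P * 'X^(a 0%N) : {poly mpoly K n}).
Proof.
rewrite /mmon big_ord_recl /= mulrC; congr (_ * _).
by rewrite rmorph_prod; apply: eq_bigr => i _; rewrite rmorphXn.
Qed.

Lemma mpoly_ind (n : nat) (P : mpoly K n -> Prop) :
  P 0 -> (forall p q, P p -> P q -> P (p + q)) ->
  (forall c a, P (mconst n c * mmon n a)) -> forall p, P p.
Proof.
elim: n P => [|n IHn] P P0 PD Pm p.
  by have := Pm p (fun=> 0%N); rewrite mmon0 mulr1.
pose q : {poly mpoly K n} := p.
have -> : p = \sum_(i < size q) (q`_i)%:P * 'X^i.
  by rewrite -[p]/q -[q in LHS]coefK poly_def; apply: eq_bigr => i _; rewrite mul_polyC.
apply: (big_ind P) => // i _; elim/IHn: q`_i => [||c a].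
- by rewrite polyC0 mul0r.
- by move=> x y Px Py; rewrite polyCD mulrDl; apply: PD.
- have := Pm c (fun j => if j is j'.+1 then a j' else i).
  by rewrite mmonS /= mulrA -polyCM.
Qed.

(* The S-valued linear functional taking the monomial of exponents s to phi s. *)
Fixpoint mlin (S : comNzRingType) (f : {rmorphism K -> S}) (n : nat)
    (phi : seq nat -> S) : mpoly K n -> S :=
  match n return mpoly K n -> S with
  | 0 => fun p => f p * phi [::]
  | n'.+1 => fun p : {poly mpoly K n'} =>
      \sum_(i < size p) mlin f (fun s => phi (val i :: s)) p`_i
  end.

Section Linear.
Variables (S : comNzRingType) (f : {rmorphism K -> S}).

(** Sums of length [size p] do not match up for two polynomials; padding with zero coefficients to a
    common length makes additivity a termwise matter. *)
Lemma mlin_wide n phi (p : {poly mpoly K n}) N :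
  (forall psi, mlin f (n := n) psi 0 = 0) -> (size p <= N)%N ->
  mlin f (n := n.+1) phi p = \sum_(i < N) mlin f (fun s => phi (val i :: s)) p`_i.
Proof.
move=> lin0 leN /=.
rewrite (big_ord_widen N (fun i => mlin f (fun s => phi (i :: s)) p`_i)) //.
rewrite big_mkcond; apply: eq_bigr => i _; case: ltnP => // le_i.
by rewrite nth_default.
Qed.

Lemma mlin0 n phi : mlin f (n := n) phi 0 = 0.
Proof.
case: n phi => [|n] phi /=; first by rewrite rmorph0 mul0r.
by rewrite size_poly0 big_ord0.
Qed.

Lemma eq_mlin n phi psi (p : mpoly K n) :
  (forall s, size s = n -> phi s = psi s) -> mlin f phi p = mlin f psi p.
Proof.
elim: n phi psi p => [|n IHn] phi psi p eq_phi /=; first by rewrite eq_phi.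
by apply: eq_bigr => i _; apply: IHn => s ss; apply: eq_phi; rewrite /= ss.
Qed.

Lemma mlin_phi0 n (p : mpoly K n) : mlin f (fun=> 0) p = 0.
Proof.
elim: n p => [|n IHn] p /=; first by rewrite mulr0.
by rewrite big1 // => i _; apply: IHn.
Qed.

Lemma mlinD n phi (p q : mpoly K n) :
  mlin f phi (p + q) = mlin f phi p + mlin f phi q.
Proof.
elim: n phi p q => [|n IHn] phi p q; first by rewrite /= rmorphD mulrDl.
pose N := maxn (size (p : {poly mpoly K n})) (size (q : {poly mpoly K n})).
rewrite !(@mlin_wide _ _ _ N) ?leq_maxl ?leq_maxr ?size_polyD //; try exact: mlin0.
by rewrite -big_split; apply: eq_bigr => i _; rewrite coefD IHn.
Qed.

Lemma mlin_mon n phi c a :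
  mlin f phi (mconst n c * mmon n a) = f c * phi (mkseq a n).
Proof.
elim: n phi a => [|n IHn] phi a; first by rewrite mmon0 mulr1.
have mkS : mkseq a n.+1 = a 0%N :: mkseq (fun i => a i.+1) n.
  by rewrite /mkseq /= (iotaDl 1 0) -map_comp.
rewrite mkS mmonS.
rewrite -[mconst n.+1 c * _]/((mconst n c)%:P * ((mmon n (fun i => a i.+1))%:P * 'X^(a 0%N))).
rewrite mulrA -polyCM (@mlin_wide _ _ _ (a 0%N).+1); first last.
- apply: leq_trans (size_polyMleq _ _) _; rewrite size_polyXn addnS /= -addn1 addnC.
  by rewrite leq_add2l size_polyC leq_b1.
- exact: mlin0.
rewrite big_ord_recr big1 /= ?add0r => [|i _].
  by rewrite coefMXn ltnn subnn coefC IHn.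
by rewrite coefMXn ltn_ord mlin0.
Qed.

Lemma mlin_sum n phi (I : Type) (r : seq I) (P : pred I) (F : I -> mpoly K n) :
  mlin f phi (\sum_(i <- r | P i) F i) = \sum_(i <- r | P i) mlin f phi (F i).
Proof. by apply: (big_morph _ (mlinD phi)); apply: mlin0. Qed.

Lemma mlinN n phi (p : mpoly K n) : mlin f phi (- p) = - mlin f phi p.
Proof. by apply/eqP; rewrite -addr_eq0 -mlinD addNr mlin0. Qed.

Lemma mlinB n phi (p q : mpoly K n) :
  mlin f phi (p - q) = mlin f phi p - mlin f phi q.
Proof. by rewrite mlinD mlinN. Qed.

End Linear.

(* All exponents occurring in p are at most N. *)
Fixpoint mbnd (N n : nat) : mpoly K n -> Prop :=
  match n return mpoly K n -> Prop with
  | 0 => fun=> True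
  | n'.+1 => fun p : {poly mpoly K n'} =>
      (size p <= N.+1)%N /\ forall i, mbnd N p`_i
  end.

Lemma mbnd_le N N' n (p : mpoly K n) : (N <= N')%N -> mbnd N p -> mbnd N' p.
Proof.
move=> leN; elim: n p => [|n IHn] p //= [sp bp]; split; last by move=> i; apply: IHn.
exact: leq_trans sp _.
Qed.

Lemma mbnd0 N n : mbnd N (0 : mpoly K n).
Proof.
by elim: n => [|n IHn] //=; split=> [|i]; rewrite ?size_poly0 // coef0.
Qed.

Lemma mbndD N n (p q : mpoly K n) : mbnd N p -> mbnd N q -> mbnd N (p + q).
Proof.
elim: n p q => [|n IHn] p q //= [sp bp] [sq bq]; split=> [|i].
  by apply: leq_trans (size_polyD _ _) _; rewrite geq_max sp.
by rewrite coefD; apply: IHn.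
Qed.

Lemma mbnd_sum N n (I : Type) (r : seq I) (P : pred I) (F : I -> mpoly K n) :
  (forall i, P i -> mbnd N (F i)) -> mbnd N (\sum_(i <- r | P i) F i).
Proof.
by move=> bF; apply: (big_ind (@mbnd N n)) => // [|p q]; [exact: mbnd0 | exact: mbndD].
Qed.

Lemma mbndM N N' n (p q : mpoly K n) :
  mbnd N p -> mbnd N' q -> mbnd (N + N') (p * q).
Proof.
elim: n p q => [|n IHn] p q //= [sp bp] [sq bq]; split=> [|i].
  apply: leq_trans (size_polyMleq _ _) _.
  have -> : (N + N').+1 = (N.+1 + N'.+1).-1 by rewrite addnS.
  by rewrite -!subn1 leq_sub2r // leq_add.
by rewrite coefM; apply: mbnd_sum => j _; apply: IHn.
Qed.

Lemma mbnd_const n (c : K) : mbnd 0 (mconst n c).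
Proof.
elim: n => [|n IHn] //=; split=> [|i]; first by rewrite size_polyC leq_b1.
by rewrite coefC; case: eqP => // _; apply: mbnd0.
Qed.

Lemma mbndX N n (p : mpoly K n) k : mbnd N p -> mbnd (N * k) (p ^+ k).
Proof.
move=> bp; elim: k => [|k IHk]; last by rewrite mulnS exprS; apply: mbndM.
by rewrite muln0 expr0; have := mbnd_const n 1; rewrite rmorph1.
Qed.

Lemma mbnd_prod n (I : finType) (N : I -> nat) (F : I -> mpoly K n) :
  (forall i, mbnd (N i) (F i)) -> mbnd (\sum_i N i) (\prod_i F i).
Proof.
move=> bF; elim/big_rec2: _ => [|i N' p _ bp]; last exact: mbndM.
by have := mbnd_const n 1; rewrite rmorph1.
Qed.

Lemma mbnd_mvar n i : mbnd 1 (mvar K n i).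
Proof.
elim: n i => [|n IHn] [|i] //=.
  split=> [|i]; first by rewrite size_polyX.
  rewrite coefX; case: eqP => _; last exact: mbnd0.
  by apply: (@mbnd_le 0) => //; have := mbnd_const n 1; rewrite rmorph1.
split=> [|j]; first by rewrite size_polyC; case: eqP.
by rewrite coefC; case: eqP => _; [apply: IHn | exact: mbnd0].
Qed.

Lemma mbnd_ex n (p : mpoly K n) : exists N, mbnd N p.
Proof.
elim/mpoly_ind: p => [|p q [N bp] [N' bq]|c a]; first by exists 0%N; apply: mbnd0.
  exists (maxn N N'); apply: mbndD.
    exact: mbnd_le (leq_maxl _ _) bp.
  exact: mbnd_le (leq_maxr _ _) bq.
exists (0 + \sum_(i < n) 1 * a i)%N; apply: mbndM; first exact: mbnd_const.
by apply: mbnd_prod => i; apply/mbndX/mbnd_mvar.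
Qed.

Lemma mlin_bnd_eq0 N n (p : mpoly K n) : mbnd N p ->
  (forall s, size s = n -> all (fun x => x <= N)%N s ->
     mlin idfun (fun t => (t == s)%:R) p = 0) -> p = 0.
Proof.
elim: n p => [|n IHn] p bp p0; first by have := p0 [::] erefl erefl; rewrite /= mulr1.
pose q : {poly mpoly K n} := p; have [sq bq] : (size q <= N.+1)%N /\ _ := bp.
apply/(@polyP (mpoly K n)) => i; rewrite coef0; case: (leqP i N) => [leiN|ltNi].
  apply: IHn => [|s ss sN]; first exact: bq.
  have := p0 (i :: s); rewrite /= ss leiN => /(_ erefl sN).
  rewrite -/q -/(mlin idfun (n := n.+1) (fun t => (t == i :: s)%:R) q).
  rewrite (@mlin_wide _ _ _ _ _ N.+1) //; last exact: mlin0.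
  rewrite (bigD1 (Ordinal (leiN : (i < N.+1)%N))) //= [X in _ + X]big1 ?addr0 => [|j neq_ji].
    move=> q0; rewrite -q0; apply: eq_mlin => t _.
    by rewrite /= eqseq_cons eqxx.
  rewrite (@eq_mlin _ _ _ _ (fun=> 0)) ?mlin_phi0 // => t _.
  by rewrite eqseq_cons; case: eqVneq => // eq_ji; case/eqP: neq_ji; apply: val_inj.
by apply: nth_default; apply: leq_trans sq _.
Qed.

(** Exponents are finite functions here, so that multiplying monomials is addition in a monoid; the
    exponents of [mmon], indexed by all of [nat], can be shifted in a recursion on [n]. *)
Definition mon (n : nat) (a : {ffun 'I_n -> nat}) : mpoly K n :=
  \prod_(i < n) mvar K n i ^+ a i.

Definition fexp (n : nat) (s : seq nat) : {ffun 'I_n -> nat} :=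
  [ffun i : 'I_n => nth 0%N s i].

Lemma mon_fexp (n : nat) (a : nat -> nat) : mmon n a = mon (fexp n (mkseq a n)).
Proof. by apply: eq_bigr => i _; rewrite ffunE nth_mkseq. Qed.

Lemma mon_mmon (n : nat) (a : {ffun 'I_n -> nat}) :
  mon a = mmon n (fun i => nth 0%N (codom a) i).
Proof.
apply: eq_bigr => i _; congr (_ ^+ _).
by rewrite (nth_map i) ?nth_ord_enum ?size_enum_ord.
Qed.

Lemma monM n (a b : {ffun 'I_n -> nat}) : mon a * mon b = mon (a + b).
Proof. by rewrite -big_split; apply: eq_bigr => i _; rewrite ffunE exprD. Qed.

Lemma mon0 n : mon (0 : {ffun 'I_n -> nat}) = 1.
Proof. by rewrite /mon big1 // => i _; rewrite ffunE. Qed.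

Lemma monX n (a : {ffun 'I_n -> nat}) k : mon a ^+ k = mon (a *+ k).
Proof. by elim: k => [|k IHk]; rewrite ?mon0 // exprS mulrS -monM IHk. Qed.

Lemma mon_sum n (I : Type) (r : seq I) (P : pred I) (F : I -> {ffun 'I_n -> nat}) :
  mon (\sum_(i <- r | P i) F i) = \prod_(i <- r | P i) mon (F i).
Proof. by apply: (big_morph (@mon n)) => [a b|]; rewrite ?monM ?mon0. Qed.

Lemma meval_mon (S : comNzRingType) (f : {rmorphism K -> S}) n x
    (a : {ffun 'I_n -> nat}) :
  meval f x (mon a) = \prod_(i < n) x i ^+ a i.
Proof.
rewrite rmorph_prod; apply: eq_bigr => i _; rewrite rmorphXn; congr (_ ^+ _).
exact: meval_mvar.
Qed.

Lemma mon_ind (n : nat) (P : mpoly K n -> Prop) :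
  P 0 -> (forall p q, P p -> P q -> P (p + q)) ->
  (forall c a, P (mconst n c * mon a)) -> forall p, P p.
Proof.
by move=> P0 PD Pm; apply: mpoly_ind => // c a; rewrite mon_fexp.
Qed.

Definition lin (S : comNzRingType) (f : {rmorphism K -> S}) (n : nat)
  (phi : {ffun 'I_n -> nat} -> S) (p : mpoly K n) : S :=
  mlin f (fun s => phi (fexp n s)) p.

Section LinearMon.
Variables (S : comNzRingType) (f : {rmorphism K -> S}) (n : nat).
Implicit Types (phi : {ffun 'I_n -> nat} -> S) (p q : mpoly K n).

Lemma lin0 phi : lin f phi 0 = 0. Proof. exact: mlin0. Qed.
Lemma linD phi p q : lin f phi (p + q) = lin f phi p + lin f phi q.
Proof. exact: mlinD. Qed.
Lemma linB phi p q : lin f phi (p - q) = lin f phi p - lin f phi q.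
Proof. exact: mlinB. Qed.
Lemma lin_sum phi (I : Type) (r : seq I) (P : pred I) (F : I -> mpoly K n) :
  lin f phi (\sum_(i <- r | P i) F i) = \sum_(i <- r | P i) lin f phi (F i).
Proof. exact: mlin_sum. Qed.

Lemma eq_lin phi psi p : phi =1 psi -> lin f phi p = lin f psi p.
Proof. by move=> eq_phi; apply: eq_mlin => s _; apply: eq_phi. Qed.

Lemma lin_cmon phi c a : lin f phi (mconst n c * mon a) = f c * phi a.
Proof.
rewrite mon_mmon /lin mlin_mon; congr (_ * phi _).
apply/ffunP => i; rewrite ffunE nth_mkseq //.
by rewrite (nth_map i) ?nth_ord_enum ?size_enum_ord.
Qed.

Lemma lin_mon phi a : lin f phi (mon a) = phi a.
Proof. by have := lin_cmon phi 1 a; rewrite !rmorph1 !mul1r. Qed.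
End LinearMon.

Lemma lin_bnd_eq0 N n (p : mpoly K n) : mbnd N p ->
  (forall a : {ffun 'I_n -> nat}, (forall i, a i <= N)%N ->
     lin idfun (fun b => (b == a)%:R) p = 0) -> p = 0.
Proof.
move=> bp p0; apply: mlin_bnd_eq0 bp _ => s ss /allP sN.
rewrite -[RHS](p0 (fexp n s)) => [|i]; last first.
  by rewrite ffunE; apply: sN; rewrite mem_nth // ss.
apply: eq_mlin => t st; congr (_ %:R); congr nat_of_bool.
apply/eqP/eqP => [-> //|eq_ts]; apply: (@eq_from_nth _ 0%N); rewrite ?st // => i lt_in.
by have /ffunP/(_ (Ordinal lt_in)) := eq_ts; rewrite !ffunE.
Qed.

Lemma lin_eq0 n (p : mpoly K n) :
  (forall a, lin idfun (fun b => (b == a)%:R) p = 0) -> p = 0.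
Proof. by have [N bp] := mbnd_ex p => p0; apply: lin_bnd_eq0 bp _ => a _. Qed.

End Monomials.

(** * Algebraic independence modulo primes, and lengths of prime chains *)

Section AlgebraicIndependence.
Local Open Scope ring_scope.
Variable K : fieldType.

Lemma mpoly_integral n (p q : mpoly K n) : p * q = 0 -> p = 0 \/ q = 0.
Proof.
elim: n p q => [|n IHn] p q.
  by move/eqP; rewrite mulf_eq0 => /orP[] /eqP ->; [left | right].
move: p q; suff H : forall p q : {poly mpoly K n}, p * q = 0 -> p = 0 \/ q = 0.
  exact: H.
move=> p q pq0; have [->|p0] := eqVneq p 0; first by left.
have [->|q0] := eqVneq q 0; first by right.
have lpq : lead_coef p * lead_coef q != 0.
  by apply/eqP => /IHn []; apply/eqP; rewrite lead_coef_eq0.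
by move: (lead_coef_proper_mul lpq); rewrite pq0 lead_coef0 => /esym/eqP; rewrite (negbTE lpq).
Qed.

Definition alg_indep m (P : mpoly K m -> Prop) k (y : nat -> mpoly K m) : Prop :=
  forall F : mpoly K k, P (meval (@mconst K m) y F) -> F = 0.

(** Dimension count: the [N ^ k] monomials in the [y i] with exponents below [N] take values in a
    space of dimension [M ^ m]. If [m < k], this dimension is too small for large [N], and a linear
    relation among the values is an algebraic relation. *)
Lemma alg_indep_le m k (y : nat -> mpoly K m) :
  alg_indep (fun p => p = 0) k y -> (k <= m)%N.
Proof.
move=> indy; rewrite leqNgt; apply/negP => lt_mk.
have [D0 bD0] : exists D, forall i : 'I_k, mbnd D (y i).
  elim: k {indy lt_mk} => [|k [D bD]]; first by exists 0%N; case.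
  have [D' bD'] := mbnd_ex (y k).
  exists (maxn D D') => i; have [lt_ik|] := ltnP i k.
    exact: mbnd_le (leq_maxl _ _) (bD (Ordinal lt_ik)).
  move=> le_ki; have -> : i = k :> nat by apply/eqP; rewrite eqn_leq le_ki -ltnS ltn_ord.
  exact: mbnd_le (leq_maxr _ _) bD'.
pose D := D0.+1.
(* With this [N], [M ^ m = (D * k) ^ m * N ^ m < N ^ m.+1 <= N ^ k]. The successor in [D] keeps [M]
   positive. *)
pose N := ((D * k) ^ m).+1; pose M := (D * k * N)%N.
have k_gt0 : (0 < k)%N by apply: leq_ltn_trans lt_mk.
have ltMN : (M ^ m < N ^ k)%N.
  have : (N ^ m.+1 <= N ^ k)%N by rewrite leq_pexp2l.
  apply: leq_trans; rewrite expnMn expnS ltn_pmul2r ?expn_gt0 //.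
pose X := {ffun 'I_k -> 'I_N}; pose Y := {ffun 'I_m -> 'I_M}.
have lt_card : (#|Y| < #|X|)%N by rewrite !card_ffun !card_ord.
pose nx (x : X) : {ffun 'I_k -> nat} := [ffun i => val (x i)].
pose ny (x : Y) : {ffun 'I_m -> nat} := [ffun i => val (x i)].
pose yx (x : X) := meval (@mconst K m) y (mon K (nx x)).
pose A : 'M[K]_(#|X|, #|Y|) :=
  \matrix_(i, j) lin idfun (fun b => (b == ny (enum_val j))%:R) (yx (enum_val i)).
have kA : kermx A != 0.
  rewrite -mxrank_eq0 mxrank_ker -lt0n subn_gt0.
  exact: leq_ltn_trans (rank_leq_col _) lt_card.
pose v := nz_row (kermx A).
have vA : v *m A = 0 by apply/eqP; rewrite -[_ == 0]sub_kermx nz_row_sub.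
have v0 : v != 0 by rewrite nz_row_eq0.
pose F : mpoly K k := \sum_i mconst k (v 0 i) * mon K (nx (enum_val i)).
have injnx : injective nx.
  move=> x x' /ffunP eqx; apply/ffunP => i; apply: val_inj.
  by have := eqx i; rewrite !ffunE.
have F0 : F = 0.
  apply: indy.
  have -> : meval (@mconst K m) y F = \sum_i mconst m (v 0 i) * yx (enum_val i).
    rewrite rmorph_sum; apply: eq_bigr => i _; rewrite rmorphM.
    by congr (_ * _); apply: meval_mconst.
  apply: (@lin_bnd_eq0 _ (M.-1)); first last.
    move=> a aM.
    have M_gt0 : (0 < M)%N by rewrite !muln_gt0 k_gt0.
    pose b : Y := [ffun i => Ordinal (leq_ltn_trans (aM i) (eq_leq (prednK M_gt0)))].
    have -> : a = ny b by apply/ffunP => i; rewrite !ffunE.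
    rewrite lin_sum.
    transitivity ((v *m A) 0 (enum_rank b)); last by rewrite vA mxE.
    rewrite mxE; apply: eq_bigr => i _; rewrite mxE enum_rankK.
    move: (yx _) => p; elim/mon_ind: p => [|p q IHp IHq|c d].
    - by rewrite mulr0 !lin0 mulr0.
    - by rewrite mulrDr !linD IHp IHq mulrDr.
    - by rewrite mulrA -rmorphM !lin_cmon /= mulrA.
  apply: mbnd_sum => i _; rewrite -[M.-1]add0n; apply: mbndM; first exact: mbnd_const.
  apply: (@mbnd_le _ (\sum_(j < k) D0 * N.-1)).
    rewrite sum_nat_const card_ord /M -ltnS (ltn_predK (m := 0)) ?muln_gt0 ?k_gt0 //.
    by rewrite /D /=; move: k_gt0; nia.
  rewrite /yx meval_mon; apply: mbnd_prod => j.
  apply: (@mbnd_le _ (D0 * nx (enum_val i) j)); last exact: mbndX.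
  by rewrite leq_mul2l ffunE /N /= -ltnS ltn_ord orbT.
case/eqP: v0; apply/rowP => i; rewrite mxE.
have := congr1 (lin idfun (fun b => (b == nx (enum_val i))%:R)) F0.
rewrite lin0 lin_sum (bigD1 i) //= lin_cmon eqxx mulr1 big1 ?addr0 // => j ji.
by rewrite lin_cmon (inj_eq injnx) (inj_eq enum_val_inj) (negbTE ji) mulr0.
Qed.

(** Read a relation [F * 'X + c] modulo [Q]: the element [f] disappears, so [c] is a relation among
    the [y] and vanishes. What is left has the factor [f]; since [P] is prime and [f] lies outside
    [P], induction applies to [F]. *)
Lemma alg_indep_step m (P Q : mpoly K m -> Prop) k y f :
  is_prime_ideal P -> is_ideal Q -> (forall x, P x -> Q x) -> Q f -> ~ P f ->
  alg_indep Q k y -> alg_indep P k.+1 (fun j => if j is j'.+1 then y j' else f).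
Proof.
move=> [_ _ primeP] [_ QD QM] PQ Qf nPf indy F.
set z := (fun j => if j is j'.+1 then y j' else f).
move: F; suff H : forall F : {poly mpoly K k},
    P (meval (@mconst K m) (n := k.+1) z F) -> F = 0 by exact: H.
elim/poly_ind => [//|F c IHF] PF.
have evF : meval (@mconst K m) (n := k.+1) z (F * 'X + c%:P) =
    meval (@mconst K m) (n := k.+1) z F * f + meval (@mconst K m) y c.
  rewrite rmorphD rmorphM; congr (_ * _ + _); first exact: mevalX.
  exact: mevalC.
have c0 : c = 0.
  apply: indy; have := PQ _ PF; rewrite evF => Qs.
  rewrite -[meval _ _ _](addKr (meval (@mconst K m) (n := k.+1) z F * f)).
  by apply: QD => //; rewrite -mulNr; apply: QM.
move: PF; rewrite evF c0 rmorph0 addr0 polyC0 addr0 => /primeP[|//].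
by move/IHF => ->; rewrite mul0r.
Qed.

(** Going down the chain, every strict inclusion contributes one more independent element; the
    [h + k] elements found at the bottom prime are independent in the polynomial ring itself. *)
Lemma prime_chain_le m (P : mpoly K m -> Prop) h k y :
  prime_chain_to P h -> alg_indep P k y -> (h + k <= m)%N.
Proof.
case=> Q [primeQ chainQ QP] indP.
suff [z indz] : exists z, alg_indep (Q 0%N) (h + k) z.
  apply: (@alg_indep_le _ _ z) => F F0; apply: indz; rewrite F0.
  by case: (primeQ 0%N isT) => [[]].
suff chain_indep i : (i <= h)%N -> exists z, alg_indep (Q (h - i)%N) (i + k) z.
  by have := chain_indep h (leqnn h); rewrite subnn.
elim: i => [|i IHi] lt_ih.
  by exists y; rewrite subn0 => F /QP; apply: indP.
have [z indz] := IHi (ltnW lt_ih).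
have lt_h : (h - i.+1 < h)%N by rewrite subnSK // leq_subr.
have [sPQ [f [Qf nPf]]] := chainQ _ lt_h.
move: sPQ Qf; rewrite subnSK // => sPQ Qf.
exists (fun j => if j is j'.+1 then z j' else f).
apply: alg_indep_step indz => //; first by apply: primeQ; rewrite leq_subr.
  by case: (primeQ (h - i)%N (leq_subr _ _)).
Qed.
End AlgebraicIndependence.

(** * Binomial generators of the toric ideal *)

Section Incidence.
Local Open Scope ring_scope.
Variables (T : finType) (e : rel T).
Local Notation m := (nedges e).

Definition edge (i : 'I_m) : T * T := tnth (in_tuple (edges e)) i.

Definition inc (i : 'I_m) (v : T) : nat := ((edge i).1 == v) + ((edge i).2 == v).

(** The incidence map of the graph, generic in the coefficients because it is applied both to
    exponents over [nat] and to vectors over [int]. *)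
Definition deg (V : nmodType) (w : {ffun 'I_m -> V}) : {ffun T -> V} :=
  [ffun v => \sum_i w i *+ inc i v].

Lemma degD (V : nmodType) (w w' : {ffun 'I_m -> V}) : deg (w + w') = deg w + deg w'.
Proof.
apply/ffunP => v; rewrite !ffunE -big_split; apply: eq_bigr => i _.
by rewrite ffunE mulrnDl.
Qed.

Lemma deg0 (V : nmodType) : deg (0 : {ffun 'I_m -> V}) = 0.
Proof. by apply/ffunP => v; rewrite !ffunE big1 // => i _; rewrite ffunE mul0rn. Qed.

Lemma degN (V : zmodType) (w : {ffun 'I_m -> V}) : deg (- w) = - deg w.
Proof. by apply/eqP; rewrite -addr_eq0 -degD addNr deg0. Qed.

Lemma degB (V : zmodType) (w w' : {ffun 'I_m -> V}) : deg (w - w') = deg w - deg w'.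
Proof. by rewrite degD degN. Qed.

Lemma deg_sum (V : nmodType) (I : Type) (r : seq I) (P : pred I)
    (F : I -> {ffun 'I_m -> V}) :
  deg (\sum_(i <- r | P i) F i) = \sum_(i <- r | P i) deg (F i).
Proof. by apply: (big_morph _ (@degD V)); apply: deg0. Qed.

Definition dvec (a : {ffun 'I_m -> nat}) : {ffun 'I_#|T| -> nat} :=
  [ffun j => deg a (enum_val j)].

Lemma dvecP a b : dvec a = dvec b <-> deg a = deg b.
Proof.
split=> [/ffunP eqd|eqd]; last by rewrite /dvec eqd.
apply/ffunP => j; have := eqd (enum_rank j).
by rewrite ffunE [dvec b _]ffunE enum_rankK.
Qed.

Lemma edge_e i : e (edge i).1 (edge i).2.
Proof.
have : edge i \in edges e by apply: mem_tnth.
by rewrite mem_filter => /andP[/andP[]].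
Qed.

Lemma edge_ex x y : symmetric e -> irreflexive e -> e x y ->
  exists i, edge i = (x, y) \/ edge i = (y, x).
Proof.
move=> e_sym e_irr.
wlog lt_xy : x y / (enum_rank x < enum_rank y)%N => [wl exy|exy].
  case: (ltngtP (enum_rank x) (enum_rank y)) => [lt|lt|/val_inj/enum_rank_inj eqxy].
  - exact: wl.
  - by have [|i [Hi|Hi]] := wl _ _ lt; [rewrite e_sym | exists i; right | exists i; left].
  - by rewrite eqxy e_irr in exy.
have : (x, y) \in edges e.
  by rewrite mem_filter /= exy lt_xy allpairs_f ?mem_enum.
by move=> /(tnthP (in_tuple _))[i xyE]; exists i; left.
Qed.

(** * Binomials in the toric ideal, and how many of them generate it *)

Section Toric.
Variable K : fieldType.

Lemma mon_indicator n (j : 'I_n) :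
  \prod_(k < n) mvar K n k ^+ (j == k) = mvar K n j.
Proof.
rewrite (bigD1 j) //= eqxx expr1 big1 ?mulr1 // => k.
by rewrite eq_sym => /negbTE ->.
Qed.

Lemma toric_mon (a : {ffun 'I_m -> nat}) :
  toric_map (mon K a) = mon K (dvec a).
Proof.
rewrite /toric_map meval_mon /mon.
under [RHS]eq_bigr => j _ do rewrite !ffunE expr_sum.
rewrite exchange_big; apply: eq_bigr => i _ /=.
have -> : \prod_(j < #|T|) mvar K #|T| j ^+ (a i *+ inc i (enum_val j)) =
    (\prod_(j < #|T|) mvar K #|T| j ^+ inc i (enum_val j)) ^+ a i.
  by rewrite -prodrXl; apply: eq_bigr => j _; rewrite -exprM mulnC -mulr_natr natn.
congr (_ ^+ _); rewrite (nth_map (edge i)) ?ltn_ord //.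
have -> : nth (edge i) (edges e) i = edge i.
  by rewrite {2}/edge (tnth_nth (edge i)).
under [RHS]eq_bigr => j _ do rewrite exprD -!(can2_eq enum_rankK enum_valK).
by rewrite big_split /= !mon_indicator.
Qed.

Lemma toricB (p q : mpoly K m) : toric_map (p - q) = toric_map p - toric_map q.
Proof. exact: rmorphB. Qed.

Lemma toricD (p q : mpoly K m) : toric_map (p + q) = toric_map p + toric_map q.
Proof. exact: rmorphD. Qed.

Lemma toricM (p q : mpoly K m) : toric_map (p * q) = toric_map p * toric_map q.
Proof. exact: rmorphM. Qed.

Lemma lin_toric (S : comNzRingType) (f : {rmorphism K -> S}) phi (p : mpoly K m) :
  lin f phi (toric_map p) = lin f (fun a => phi (dvec a)) p.
Proof.
elim/mon_ind: p => [|p q IHp IHq|c a]; first by rewrite /toric_map rmorph0 !lin0.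
  by rewrite /toric_map rmorphD !linD -IHp -IHq.
rewrite lin_cmon -(lin_cmon _ phi) /toric_map rmorphM; congr (lin _ _ (_ * _)).
  exact: meval_mconst.
exact: toric_mon.
Qed.

Definition bin (u : {ffun 'I_m -> nat} * {ffun 'I_m -> nat}) : mpoly K m :=
  mon K u.1 - mon K u.2.

Lemma toric_bin u : toric_ideal (bin u) <-> deg u.1 = deg u.2.
Proof.
rewrite /toric_ideal toricB !toric_mon -dvecP; split=> [/eqP|->]; last by rewrite subrr.
move=> /eqP/(congr1 (lin idfun (fun b => (b == dvec u.1)%:R))).
rewrite linB lin0 !lin_mon eqxx; case: eqP => [//|_] /eqP.
by rewrite subr0 oner_eq0.
Qed.

(** The ideal generated by the binomials of [U], as the intersection of all ideals containing them;
    a property of its members is proved by taking that property for [J]. *)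
Definition gen (U : seq ({ffun 'I_m -> nat} * {ffun 'I_m -> nat})) (p : mpoly K m) :=
  forall J, is_ideal J -> (forall u, u \in U -> J (bin u)) -> J p.

Lemma gen_ideal U : is_ideal (gen U).
Proof.
split=> [J [J0 _ _] //|x y gx gy J idJ UJ|r x gx J idJ UJ]; case: (idJ) => J0 JD JM.
- by apply: JD; [apply: gx | apply: gy].
- by apply: JM; apply: gx.
Qed.

Lemma gen_bin U u : u \in U -> gen U (bin u).
Proof. by move=> Uu J _; apply. Qed.

Lemma gen_trans U V p : (forall u, u \in U -> gen V (bin u)) -> gen U p -> gen V p.
Proof. by move=> UV; apply=> //; apply: gen_ideal. Qed.

Lemma gen_sub U V p : {subset U <= V} -> gen U p -> gen V p.
Proof. by move=> sUV; apply: gen_trans => u /sUV /gen_bin. Qed.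

Lemma ideal_sum (R : comNzRingType) (J : R -> Prop) (I : Type) (r : seq I) (P : pred I)
    (F : I -> R) :
  is_ideal J -> (forall i, P i -> J (F i)) -> J (\sum_(i <- r | P i) F i).
Proof. by case=> J0 JD _ JF; apply: (big_ind J). Qed.

Lemma ideal_opp (R : comNzRingType) (J : R -> Prop) x : is_ideal J -> J x -> J (- x).
Proof. by case=> _ _ JM Jx; rewrite -mulN1r; apply: JM. Qed.

Lemma toric_is_prime : is_prime_ideal (@toric_ideal _ e K).
Proof.
rewrite /toric_ideal; split; first split=> [|x y x0 y0|r x x0].
- by rewrite /toric_map rmorph0.
- by rewrite toricD x0 y0 addr0.
- by rewrite toricM x0 mulr0.
- by rewrite /toric_map rmorph1; apply/eqP; rewrite oner_eq0.
- by move=> x y; rewrite toricM; apply: mpoly_integral.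
Qed.

(** Group the terms of [p] by the boundary of their exponents and replace each monomial by one
    representative of its group. As the toric map kills [p], the coefficients of each group sum to
    zero, so [p] is a combination of differences of monomials with equal boundary. *)
Lemma toric_gen1 (p : mpoly K m) : toric_ideal p ->
  exists U, (forall u, u \in U -> deg u.1 = deg u.2) /\ gen U p.
Proof.
move=> Ip.
have [l pE] : exists l : seq (K * {ffun 'I_m -> nat}),
    p = \sum_(x <- l) mconst m x.1 * mon K x.2.
  elim/mon_ind: p {Ip} => [|p q [l ->] [l' ->]|c a].
  - by exists [::]; rewrite big_nil.
  - by exists (l ++ l'); rewrite big_cat.
  - by exists [:: (c, a)]; rewrite big_seq1.
pose s := map snd l.
pose rep d := nth 0 s (find (fun a => dvec a == d) s).
pose U := [seq x <- [seq (a, b) | a <- s, b <- s] | deg x.1 == deg x.2].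
exists U; split=> [u|]; first by rewrite mem_filter => /andP[/eqP].
(* This sum is the image of [toric_map p] under the linear map that sends the monomial of exponents
   [d] to that of [rep d]. *)
have rep0 : \sum_(x <- l) mconst m x.1 * mon K (rep (dvec x.2)) = 0.
  transitivity (lin (@mconst K m) (fun d => mon K (rep d)) (toric_map p)).
    rewrite lin_toric pE lin_sum; apply: eq_bigr => x _.
    by rewrite lin_cmon.
  by rewrite Ip lin0.
rewrite -[p]subr0 -rep0 pE -sumrB big_seq; apply: ideal_sum => [|x lx].
  exact: gen_ideal.
rewrite -mulrBr; have [_ _ gM] := gen_ideal U; apply: gM.
have sx : x.2 \in s by apply: map_f.
have hx : has (fun a => dvec a == dvec x.2) s by apply/hasP; exists x.2.
apply: (@gen_bin _ (x.2, rep (dvec x.2))); rewrite mem_filter; apply/andP; split.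
  by have /eqP/dvecP/= -> := nth_find 0 hx.
by apply: allpairs_f => //; rewrite mem_nth // -has_find.
Qed.

Lemma toric_gen (l : seq (mpoly K m)) : (forall p, p \in l -> toric_ideal p) ->
  exists U, (forall u, u \in U -> deg u.1 = deg u.2) /\ (forall p, p \in l -> gen U p).
Proof.
elim: l => [|p l IHl] Il; first by exists [::].
have [|U [Udeg Ul]] := IHl; first by move=> q lq; apply: Il; rewrite inE lq orbT.
have [|V [Vdeg Vp]] := @toric_gen1 p; first by apply: Il; rewrite inE eqxx.
exists (U ++ V); split=> [u|q]; first by rewrite mem_cat => /orP[/Udeg|/Vdeg].
rewrite inE => /orP[/eqP->|/Ul gq]; last first.
  by apply: gen_sub gq => u Uu; rewrite mem_cat Uu.
by apply: gen_sub Vp => u Vu; rewrite mem_cat Vu orbT.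
Qed.

(** Summing coefficients over the monomials in [phi] kills every monomial multiple of a binomial of
    [U], since both of its terms are in [phi] or neither is. *)
Lemma gen_class U (phi : pred {ffun 'I_m -> nat}) p :
  (forall u, u \in U -> forall a, phi (a + u.1) = phi (a + u.2)) ->
  gen U p -> lin idfun (fun b => (phi b)%:R : K) p = 0.
Proof.
move=> Uphi gp.
(* The multiplier [c] turns the property into one that defines an ideal. *)
suff H : forall c, lin idfun (fun b => (phi b)%:R : K) (c * p) = 0.
  by have := H 1; rewrite mul1r.
apply: (gp (fun p => forall c, lin idfun (fun b => (phi b)%:R : K) (c * p) = 0)).
  split=> [c|x y x0 y0 c|r x x0 c]; first by rewrite mulr0 lin0.
    by rewrite mulrDr linD x0 y0 addr0.
  by rewrite mulrA.
move=> u Uu c; elim/mon_ind: c => [|p' q IHp IHq|c a]; first by rewrite mul0r lin0.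
  by rewrite mulrDl linD IHp IHq addr0.
by rewrite /bin mulrBr -!mulrA !monM linB !lin_cmon Uphi // subrr.
Qed.

Lemma gen_class_bin U (phi : pred {ffun 'I_m -> nat}) v :
  (forall u, u \in U -> forall a, phi (a + u.1) = phi (a + u.2)) ->
  gen U (bin v) -> phi v.1 = phi v.2.
Proof.
move=> Uphi /(gen_class Uphi); rewrite linB !lin_mon.
case: (phi v.1) (phi v.2) => -[] //; rewrite ?subr0 ?sub0r => /eqP.
  by rewrite oner_eq0.
by rewrite oppr_eq0 oner_eq0.
Qed.

Definition msize (a : {ffun 'I_m -> nat}) : nat := (\sum_i a i)%N.

Lemma msizeD a b : msize (a + b) = (msize a + msize b)%N.
Proof. by rewrite -big_split; apply: eq_bigr => i _; rewrite ffunE. Qed.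

Lemma msize_eq0 a : msize a = 0%N -> a = 0.
Proof.
move=> /eqP; rewrite sum_nat_eq0 => /forallP a0.
by apply/ffunP => i; rewrite ffunE; apply/eqP/(a0 i).
Qed.

(** Every edge has two ends, so a boundary sums to twice the size; hence the binomials of the toric
    ideal are homogeneous. *)
Lemma deg_msize a b : deg a = deg b -> msize a = msize b.
Proof.
suff sumdeg c : (\sum_v deg c v = (msize c).*2)%N.
  by move=> eqd; apply: double_inj; rewrite -!sumdeg eqd.
rewrite (eq_bigr (fun v => \sum_i (c i * inc i v))%N) => [|v _]; last first.
  by rewrite ffunE; apply: eq_bigr => i _; rewrite -mulr_natr natn.
rewrite exchange_big -muln2 big_distrl /=; apply: eq_bigr => i _.
rewrite -big_distrr /= big_split /=; congr (_ * _)%N.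
suff sum1 x : (\sum_v (x == v :> T) = 1)%N by rewrite !sum1.
by rewrite (bigD1 x) //= eqxx big1 // => v /negbTE; rewrite eq_sym => ->.
Qed.

Lemma gen_toric U p : (forall u, u \in U -> deg u.1 = deg u.2) ->
  gen U p -> toric_ideal p.
Proof.
move=> Udeg; apply; first by case: toric_is_prime.
by move=> u /Udeg /toric_bin.
Qed.

Definition mcst (p : mpoly K m) : K := meval idfun (fun=> 0) p.

(** A graded Nakayama argument. Written over the [h] generators, the binomials have coefficients
    whose constant terms form a matrix with more rows than columns, so a nontrivial [K]-combination
    of the binomials lies in the irrelevant ideal times the toric ideal. A binomial of nonzero
    weight in it is generated by the others. *)
Lemma toric_gen_drop h U :
  generated_by (@toric_ideal _ e K) h -> (h < size U)%N -> uniq U ->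
  (forall u, u \in U -> deg u.1 = deg u.2) ->
  (forall p, toric_ideal p -> gen U p) ->
  exists2 u, u \in U & forall p, toric_ideal p -> gen (rem u U) p.
Proof.
move=> [g Ig] lt_hU uniqU Udeg genU; pose k := size U.
pose u_ (i : 'I_k) := tnth (in_tuple U) i.
have u_U i : u_ i \in U by apply: mem_tnth.
have fI i : exists c : h.-tuple (mpoly K m), bin (u_ i) = \sum_(j < h) tnth c j * tnth g j.
  by apply/Ig/toric_bin/Udeg.
have [c fE] : exists c : 'I_k -> 'I_h -> mpoly K m,
    forall i, bin (u_ i) = \sum_(j < h) c i j * tnth g j.
  pose c i := proj1_sig (constructive_indefinite_description _ (fI i)).
  exists (fun i j => tnth (c i) j) => i.
  exact: proj2_sig (constructive_indefinite_description _ (fI i)).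
pose A : 'M[K]_(k, h) := \matrix_(i, j) mcst (c i j).
have kA : kermx A != 0.
  rewrite -mxrank_eq0 mxrank_ker -lt0n subn_gt0.
  exact: leq_ltn_trans (rank_leq_col _) lt_hU.
pose l := nz_row (kermx A).
have lA : l *m A = 0 by apply/eqP; rewrite -[_ == 0]sub_kermx nz_row_sub.
have [i0 li0] : exists i, l 0 i != 0.
  apply/existsP; apply: contraT => /existsPn l0; case/negP: kA.
  rewrite -nz_row_eq0; apply/eqP/rowP => i; rewrite mxE.
  by apply/eqP; rewrite -[_ == _]negbK l0.
exists (u_ i0) => // p Ip; apply: gen_trans (genU _ Ip) => u Uu.
set V := rem _ U; have [->|neq_u] := eqVneq u (u_ i0); last first.
  by apply: gen_bin; rewrite mem_rem_uniq // inE neq_u.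
set u0 := u_ i0 in V *; have Vdeg v : v \in V -> deg v.1 = deg v.2.
  by move/mem_rem; apply: Udeg.
(* [phi] is the class of the monomials congruent to that of [u0.1] modulo the remaining binomials;
   [lphi] will sum the coefficients over this class. *)
pose phi a : bool := if excluded_middle_informative (gen V (bin (a, u0.1))) then true else false.
have phiP a : reflect (gen V (bin (a, u0.1))) (phi a).
  by rewrite /phi; case: excluded_middle_informative => H; constructor.
have [g0 gD gM] := gen_ideal V.
have Vphi v a : v \in V -> phi (a + v.1) = phi (a + v.2).
  move=> Vv; have gv : gen V (mon K (a + v.1) - mon K (a + v.2)).
    by rewrite -!monM -mulrBr; apply: gM; apply: gen_bin.
  apply/phiP/phiP => gav; rewrite /bin /= in gav *.
    by rewrite -(subrKA (mon K (a + v.1))); apply: gD => //; rewrite -opprB; apply: ideal_opp (gen_ideal V) gv.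
  by rewrite -(subrKA (mon K (a + v.2))); apply: gD.
have phi_size a : phi a -> msize a = msize u0.1.
  by move=> /phiP /(gen_toric Vdeg) /toric_bin /deg_msize.
pose lphi := lin idfun (fun b => (phi b)%:R : K).
have lphi_const d q : lphi (mconst m d * q) = d * lphi q.
  elim/mon_ind: q => [|q q' IHq IHq'|d' a]; first by rewrite mulr0 /lphi lin0 mulr0.
    by rewrite mulrDr /lphi !linD -!/(lphi _) IHq IHq' mulrDr.
  by rewrite mulrA -rmorphM /lphi !lin_cmon /= mulrA.
have lphi_V v : v \in V -> lphi (bin v) = 0.
  move=> Vv; rewrite /lphi /bin linB !lin_mon; have := Vphi v 0 Vv.
  by rewrite !add0r => ->; rewrite subrr.
have mcst_mon a : mcst (mon K a) = (msize a == 0%N)%:R.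
  rewrite /mcst meval_mon; have [/msize_eq0 ->|a0] := eqVneq.
    by rewrite big1 // => i _; rewrite ffunE.
  have [i ai] : exists i, a i != 0%N.
    apply/existsP; apply: contraNT a0 => /existsPn a0.
    by apply/eqP/big1 => i _; apply/eqP; rewrite -[_ == _]negbK a0.
  by rewrite (bigD1 i) //= expr0n (negbTE ai) mul0r.
(* For the other binomials both sides vanish. For [u0], a monomial factor of positive size moves
   both terms out of the class, whose members all have the size of [u0.1]. *)
have JU v : v \in U -> forall d, lphi (d * bin v) = mcst d * lphi (bin v).
  move=> Uv d; elim/mon_ind: d => [|d d' IHd IHd'|d a].
  - by rewrite mul0r /lphi lin0 /mcst rmorph0 mul0r.
  - by rewrite mulrDl /lphi linD -!/(lphi _) IHd IHd' /mcst rmorphD mulrDl.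
  - have -> : mcst (mconst m d * mon K a) = d * mcst (mon K a).
      by rewrite /mcst rmorphM; congr (_ * _); apply: meval_mconst.
    rewrite -mulrA lphi_const mcst_mon -mulrA; congr (_ * _).
    have [a0|a0] := eqVneq; first by rewrite (msize_eq0 a0) mon0 !mul1r.
    rewrite mul0r; have [->|neq_v] := eqVneq v u0; last first.
      have Vv : v \in V by rewrite mem_rem_uniq // inE neq_v.
      by rewrite /bin mulrBr !monM /lphi linB !lin_mon Vphi // subrr.
    rewrite /bin mulrBr !monM /lphi linB !lin_mon.
    have phiF b : msize b = msize u0.1 -> phi (a + b) = false.
      move=> sb; apply/negP => /phi_size /eqP; rewrite msizeD sb -[X in _ == X]add0n.
      by rewrite eqn_add2r (negbTE a0).
    have su : msize u0.2 = msize u0.1 by apply/esym/deg_msize/Udeg/u_U.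
    by rewrite !phiF ?subrr.
have Jg q : toric_ideal q -> forall d, lphi (d * q) = mcst d * lphi q.
  move=> Iq; apply: (genU q Iq (fun q => forall d, lphi (d * q) = mcst d * lphi q)) => //.
  split=> [d|x y x0 y0 d|r x x0 d]; first by rewrite mulr0 /lphi lin0 mulr0.
    by rewrite mulrDr /lphi !linD -!/(lphi _) x0 y0 mulrDr.
  by rewrite mulrA !x0 /mcst rmorphM mulrA.
(* Over the generators, the multipliers have the entries of [l *m A], which is zero, as constant
   terms. Over the binomials, the value is [l 0 i0 * lphi (bin u0)], so [u0.2] must be in the class
   of [u0.1]. *)
have : lphi (\sum_i mconst m (l 0 i) * bin (u_ i)) = 0.
  have -> : \sum_i mconst m (l 0 i) * bin (u_ i) =
      \sum_j (\sum_i mconst m (l 0 i) * c i j) * tnth g j.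
    under eq_bigr => i _ do rewrite fE mulr_sumr.
    rewrite exchange_big; apply: eq_bigr => j _; rewrite mulr_suml.
    by apply: eq_bigr => i _; rewrite mulrA.
  rewrite /lphi lin_sum big1 // => j _; rewrite -/(lphi _) Jg; last first.
    apply/Ig; exists [tuple (i == j)%:R | i < h].
    rewrite (bigD1 j) //= tnth_mktuple eqxx mul1r big1 ?addr0 // => i ij.
    by rewrite tnth_mktuple (negbTE ij) mul0r.
  have -> : mcst (\sum_i mconst m (l 0 i) * c i j) = (l *m A) 0 j.
    rewrite /mcst rmorph_sum mxE; apply: eq_bigr => i _; rewrite rmorphM mxE.
    by congr (_ * _); apply: meval_mconst.
  by rewrite lA mxE mul0r.
rewrite /lphi lin_sum (bigD1 i0) //= -/(lphi _) big1 ?addr0 => [|i ii0]; last first.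
  rewrite -/(lphi _) lphi_const lphi_V ?mulr0 // mem_rem_uniq // inE u_U andbT.
  by apply: contra ii0; rewrite /u0 /u_ (tnth_nth u0) [tnth _ i0](tnth_nth u0) nth_uniq.
rewrite lphi_const => /eqP; rewrite mulf_eq0 (negbTE li0) /= /lphi linB !lin_mon.
have -> : phi u0.1 by apply/phiP; rewrite /bin subrr.
case: (phiP u0.2) => [gu _|_]; last by rewrite subr0 oner_eq0.
by rewrite -[bin u0]opprK opprB; apply: ideal_opp gu; apply: gen_ideal.
Qed.

Lemma toric_gen_le h : generated_by (@toric_ideal _ e K) h ->
  exists U, [/\ (size U <= h)%N, (forall u, u \in U -> deg u.1 = deg u.2) &
    (forall p, toric_ideal p -> gen U p)].
Proof.
move=> Gh; have [g Ig] := Gh.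
have Ig1 p : p \in tval g -> toric_ideal p.
  move=> /tnthP[j ->]; apply/Ig; exists [tuple (i == j)%:R | i < h].
  rewrite (bigD1 j) //= tnth_mktuple eqxx mul1r big1 ?addr0 // => i ij.
  by rewrite tnth_mktuple (negbTE ij) mul0r.
have [U0 [U0deg U0g]] := toric_gen Ig1.
have : exists U, [/\ uniq U, (forall u, u \in U -> deg u.1 = deg u.2) &
    (forall p, toric_ideal p -> gen U p)].
  exists (undup U0); split; first exact: undup_uniq.
    by move=> u; rewrite mem_undup; apply: U0deg.
  move=> p /Ig[c ->]; apply: ideal_sum => [|i _]; first exact: gen_ideal.
  have [_ _ gM] := gen_ideal (undup U0); apply: gM.
  by apply: gen_sub (U0g _ (mem_tnth _ _)) => u; rewrite mem_undup.
case=> U; move: {2}(size U) (leqnn (size U)) => n; elim: n U => [|n IHn] U leU [uU dU gU].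
  by exists U; split=> //; apply: leq_trans leU _.
have [leUh|ltU] := leqP (size U) h; first by exists U.
have [u Uu gu] := toric_gen_drop Gh ltU uU dU gU.
apply: (IHn (rem u U)); first by rewrite size_rem //; case: (size U) leU.
by split=> //; [rewrite rem_uniq | move=> v /mem_rem /dU].
Qed.
End Toric.
End Incidence.

(** * The lattice of the incidence map modulo 2 *)

Section Lattice.
Local Open Scope ring_scope.
Variables (T : finType) (e : rel T).
Local Notation m := (nedges e).
Implicit Types (S : {set T}) (w : {ffun 'I_m -> int}).

Definition posn (z : int) : nat := if z is Posz n then n else 0%N.

Definition natf (I : finType) (a : {ffun I -> nat}) : {ffun I -> int} :=
  [ffun i => (a i)%:R].

Definition posf (I : finType) (w : {ffun I -> int}) : {ffun I -> nat} :=
  [ffun i => posn (w i)].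

Lemma natfD (I : finType) (a b : {ffun I -> nat}) : natf (a + b) = natf a + natf b.
Proof. by apply/ffunP => i; rewrite !ffunE natrD. Qed.

Lemma natf_inj (I : finType) : injective (@natf I).
Proof.
move=> a b /ffunP eqab; apply/ffunP => i; have := eqab i.
by rewrite !ffunE !natz => -[].
Qed.

Lemma natf_posf (I : finType) (w : {ffun I -> int}) :
  natf (posf w) - natf (posf (- w)) = w.
Proof.
by apply/ffunP => i; rewrite !ffunE; case: (w i) => [[|n]|n]; rewrite ?subr0 ?sub0r ?natz.
Qed.

Lemma deg_natf (a : {ffun 'I_m -> nat}) : deg (natf a) = natf (deg a).
Proof.
apply/ffunP => v; rewrite !ffunE (big_morph _ (natrD _) (erefl : 0%:R = 0)).
apply: eq_bigr => i _; rewrite ffunE.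
by elim: (inc i v) => [//|k IHk]; rewrite !mulrS natrD IHk.
Qed.

Lemma deg_posf (w : {ffun 'I_m -> int}) : deg w = 0 -> deg (posf w) = deg (posf (- w)).
Proof.
move=> w0; apply: natf_inj; apply/eqP; rewrite -subr_eq0 -!deg_natf -degB natf_posf.
by rewrite w0.
Qed.

Definition vtx (x : T) : {ffun T -> int} := [ffun v => (x == v)%:R].

(** In a connected non-bipartite graph any two vertices are joined by walks of both parities, whence
    this property; it gives the incidence map full rank. *)
Hypothesis deg_vtx2 : forall x y, exists p : {ffun 'I_m -> int}, deg p = vtx x + vtx y.

Lemma degMn (w : {ffun 'I_m -> nat}) k : deg (w *+ k) = deg w *+ k.
Proof. by elim: k => [|k IHk]; rewrite ?deg0 // !mulrS degD IHk. Qed.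

(** * Upper bound on the height of the toric ideal *)

Section Height.
Variable K : fieldType.

(** The integer vectors [q x], with boundary twice [x], become exponents once [N], the sum of all
    negative parts, is added. The toric map then sends distinct monomials in the resulting elements
    to distinct monomials. *)
Lemma toric_alg_indep : exists y, alg_indep (@toric_ideal _ e K) #|T| y.
Proof.
pose q x := proj1_sig (constructive_indefinite_description _ (deg_vtx2 x x)).
have qE x : deg (q x) = vtx x + vtx x.
  exact: proj2_sig (constructive_indefinite_description _ (deg_vtx2 x x)).
pose N := \sum_x posf (- q x).
pose E x := posf (q x) + \sum_(z | z != x) posf (- q z).
have EE x : natf (E x) = q x + natf N.
  rewrite /N (bigD1 x) //= /E !natfD addrA; congr (_ + _).
  by apply/eqP; rewrite -subr_eq natf_posf.
have degE x : deg (E x) = deg N + [ffun v => (x == v).*2].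
  apply: natf_inj; rewrite -deg_natf EE degD qE deg_natf natfD addrC; congr (_ + _).
  by apply/ffunP => v; rewrite !ffunE -addnn natrD.
pose y k := if insub k is Some j then mon K (E (enum_val (j : 'I_#|T|))) else 0.
exists y => F; rewrite /toric_ideal => F0.
pose B (a : {ffun 'I_#|T| -> nat}) := dvec (\sum_j E (enum_val j) *+ a j).
have linB phi : lin idfun phi (toric_map (meval (@mconst K m) y F)) =
    lin idfun (fun a => phi (B a)) F.
  rewrite lin_toric; elim/mon_ind: F {F0} => [|p p' IHp IHp'|c a].
  - by rewrite rmorph0 !lin0.
  - by rewrite rmorphD !linD IHp IHp'.
  have -> : meval (@mconst K m) y (mconst #|T| c * mon K a) =
      mconst m c * mon K (\sum_j E (enum_val j) *+ a j).
    rewrite rmorphM; congr (_ * _); first exact: meval_mconst.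
    apply: etrans (meval_mon _ _ _) _; rewrite mon_sum.
    by apply: eq_bigr => j _; rewrite -monX /y valK.
  by rewrite !lin_cmon.
have injB : injective B.
  move=> a a' eqB.
  pose b j := deg N (enum_val (j : 'I_#|T|)).
  have BE c j : B c j = (b j * (\sum_k c k) + (c j).*2)%N.
    rewrite ffunE deg_sum sum_ffunE.
    rewrite (eq_bigr (fun k => b j * c k + (k == j).*2 * c k)%N) => [|k _]; last first.
      rewrite degMn degE ffunMnE !ffunE (inj_eq enum_val_inj) -mulr_natr natn -mulnDl.
      by rewrite /b ffunE.
    rewrite big_split /= -big_distrr /=; congr (_ + _)%N.
    rewrite (bigD1 j) //= eqxx big1 => [|k /negbTE -> //].
    by rewrite mul2n; apply: addn0.
  (* Summing the coordinates of [B] first recovers the total exponent; what remains is then twice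
     the exponent itself. *)
  have eqs : (\sum_k a k = \sum_k a' k)%N.
    have sumB c : (\sum_j B c j = ((\sum_j b j) + 2) * \sum_k c k)%N.
      rewrite (eq_bigr _ (fun j _ => BE c j)) big_split /= -big_distrl /= mulnDl.
      by congr (_ + _)%N; rewrite mul2n -mul2n big_distrr /=; apply: eq_bigr => k _; rewrite mul2n.
    apply/eqP; have /eqP := congr1 (fun f : {ffun 'I_#|T| -> nat} => \sum_j f j)%N eqB.
    by rewrite !sumB eqn_pmul2l // addn_gt0 orbT.
  apply/ffunP => j; have /eqP := congr1 (fun f : {ffun 'I_#|T| -> nat} => f j) eqB.
  by rewrite !BE eqs eqn_add2l => /eqP/double_inj.
apply: lin_eq0 => a; rewrite (@eq_lin _ _ _ _ _ (fun b => (B b == B a)%:R)) => [|b]; last first.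
  by rewrite (inj_eq injB).
by rewrite -(linB (fun d => (d == B a)%:R)) F0 lin0.
Qed.

Lemma toric_chain_le h : prime_chain_to (@toric_ideal _ e K) h -> (h + #|T| <= m)%N.
Proof. by have [y indy] := toric_alg_indep => /prime_chain_le; apply; apply: indy. Qed.
End Height.

Definition red (w : {ffun 'I_m -> int}) : 'rV['F_2]_m := \row_i (w i)%:~R.

Lemma redD w w' : red (w + w') = red w + red w'.
Proof. by apply/rowP => i; rewrite !mxE ffunE intrD. Qed.

Lemma redN w : red (- w) = - red w.
Proof. by apply/rowP => i; rewrite !mxE ffunE mulrNz. Qed.

Lemma redB w w' : red (w - w') = red w - red w'.
Proof. by rewrite redD redN. Qed.

Lemma red0 : red 0 = 0.
Proof. by apply/rowP => i; rewrite !mxE ffunE. Qed.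

Lemma red_sum (I : Type) (r : seq I) (P : pred I) (F : I -> {ffun 'I_m -> int}) :
  red (\sum_(i <- r | P i) F i) = \sum_(i <- r | P i) red (F i).
Proof. by apply: (big_morph _ redD); apply: red0. Qed.

Definition supp_in (S : {set T}) (V : nmodType) (w : {ffun 'I_m -> V}) : bool :=
  [forall i, (w i != 0) ==> ((edge i).1 \in S) && ((edge i).2 \in S)].

Lemma supp_inP S (V : nmodType) (w : {ffun 'I_m -> V}) :
  reflect (forall i, w i != 0 -> (edge i).1 \in S /\ (edge i).2 \in S) (supp_in S w).
Proof.
apply: (iffP forallP) => H i; first by move=> wi; have := H i; rewrite wi => /andP.
by apply/implyP => /H /andP.
Qed.

(** Over [nat] nothing cancels, so the support can be read off the boundary; two exponents with the
    same boundary therefore live on the same vertex sets. *)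
Lemma supp_in_inc S (w : {ffun 'I_m -> nat}) :
  supp_in S w = [forall v, (deg w v != 0%N) ==> (v \in S)].
Proof.
have deg_gt0 i v : w i != 0 -> (inc i v != 0)%N -> deg w v != 0%N.
  move=> wi iv; rewrite ffunE (bigD1 i) //= -lt0n addn_gt0.
  by rewrite -mulr_natr natn muln_gt0 !lt0n wi iv.
apply/supp_inP/forallP => [wS v|wS i wi].
  apply/implyP; apply: contraR => nvS; rewrite ffunE big1 // => i _.
  have [->|/wS[S1 S2]] := eqVneq (w i) 0; first by rewrite mul0rn.
  rewrite /inc; case: eqP => [v1|_]; first by rewrite -v1 S1 in nvS.
  by case: eqP => [v2|//]; rewrite -v2 S2 in nvS.
split; [have := wS (edge i).1 | have := wS (edge i).2]; rewrite (deg_gt0 i) //.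
  by rewrite /inc eqxx.
by rewrite /inc eqxx addnC.
Qed.

(* The vectors of the lattice L_S of the subgraph induced on S. *)
Definition lat (S : {set T}) (w : {ffun 'I_m -> int}) : Prop :=
  deg w = 0 /\ supp_in S w.

Lemma supp_inD S w w' : supp_in S (w : {ffun 'I_m -> int}) -> supp_in S w' -> supp_in S (w + w').
Proof.
move=> /supp_inP wS /supp_inP wS'; apply/supp_inP => i; rewrite ffunE => wi.
by have [w0|/wS] := eqVneq (w i) 0; [apply: wS'; rewrite w0 add0r in wi | ].
Qed.

Lemma supp_in0 S (V : nmodType) : supp_in S (0 : {ffun 'I_m -> V}).
Proof. by apply/supp_inP => i; rewrite ffunE eqxx. Qed.

Lemma supp_inN S w : supp_in S (w : {ffun 'I_m -> int}) -> supp_in S (- w).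
Proof. by move=> /supp_inP wS; apply/supp_inP => i; rewrite ffunE oppr_eq0; apply: wS. Qed.

Lemma supp_inB S w w' : supp_in S (w : {ffun 'I_m -> int}) -> supp_in S w' -> supp_in S (w - w').
Proof. by move=> wS wS'; apply: supp_inD => //; apply: supp_inN. Qed.

Lemma supp_in_sub S S' (V : nmodType) (w : {ffun 'I_m -> V}) :
  S \subset S' -> supp_in S w -> supp_in S' w.
Proof.
by move=> /subsetP sS /supp_inP wS; apply/supp_inP => i /wS[/sS + /sS].
Qed.

Lemma lat0 S : lat S 0.
Proof. by split; [apply: deg0 | apply: supp_in0]. Qed.

Lemma latD S w w' : lat S w -> lat S w' -> lat S (w + w').
Proof. by move=> [w0 wS] [w0' wS']; split; [rewrite degD w0 w0' addr0 | apply: supp_inD]. Qed.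

Lemma lat_sub S S' w : S \subset S' -> lat S w -> lat S' w.
Proof. by move=> sS [w0 wS]; split=> //; apply: supp_in_sub wS. Qed.

Lemma F2_neq0 (x : 'F_2) : x != 0 -> x = 1.
Proof. by case: x => -[|[|k]] lt_k //= _; apply: val_inj. Qed.

(** * Distributivity of the sublattices modulo 2 *)

Section Distributivity.
Variable K : fieldType.
Hypothesis ci : complete_intersection e K.
Variable r : T.

(* At most m - #|T| binomial generators form, mod 2, an F_2-basis of the lattice which
   restricts to a basis of every sublattice L_S: this makes the L_S distributive. *)
Lemma lat_distr S S1 S2 w w1 w2 :
  lat S w -> lat S1 w1 -> lat S2 w2 -> red w = red w1 + red w2 ->
  exists w1' w2', [/\ lat (S :&: S1) w1', lat (S :&: S2) w2' &
    red w = red w1' + red w2'].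
Proof.
case: ci => h [[Hh _] Gh].
have h_le : (h + #|T| <= m)%N.
  by apply: (@toric_chain_le K); apply: Hh => //; apply: toric_is_prime.
have [U [Uh Udeg genU]] := toric_gen_le Gh.
pose k := size U; pose u (i : 'I_k) := tnth (in_tuple U) i.
pose uv i := natf (u i).1 - natf (u i).2.
have uU i : u i \in U by apply: mem_tnth.
have uv0 i : deg (uv i) = 0 by rewrite degB !deg_natf Udeg // subrr.
pose A : 'M['F_2]_(k, m) := \matrix_i red (uv i).
pose AS S0 : 'M['F_2]_(k, m) := \matrix_i (if supp_in S0 (uv i) then red (uv i) else 0).
(* The positive and negative parts of [w0] form a binomial of the toric ideal. The exponents with
   the boundary of [a] whose difference from [b] lies mod 2 in the row span of [AS S0] form a class
   respected by all generators; it contains [b], hence [a]. *)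
have span S0 w0 : lat S0 w0 -> (red w0 <= AS S0)%MS.
  move=> [w0d w0S]; pose a := posf w0; pose b := posf (- w0).
  have eqab : deg a = deg b by apply: deg_posf.
  have aS : [forall v, (deg a v != 0%N) ==> (v \in S0)].
    rewrite -supp_in_inc; apply/supp_inP => i; rewrite ffunE => ai.
    by have /supp_inP := w0S; apply; apply: contraNneq ai => ->.
  pose phi c := (deg c == deg a) && (red (natf c - natf b) <= AS S0)%MS.
  suff : phi a = phi b.
    by rewrite /phi eqxx eqab eqxx !subrr red0 sub0mx natf_posf /= => ->.
  suff Uphi v : v \in U -> forall c, phi (c + v.1) = phi (c + v.2).
    apply: (@gen_class_bin _ _ K U phi (a, b) Uphi); apply: genU.
    exact/toric_bin.
  move=> Uv c; have [i ->] : exists i, v = u i by apply/tnthP.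
  rewrite /phi !degD (Udeg _ (uU i)); case: eqP => //= dega.
  (* Both monomials of [u i] divide monomials with the boundary of [a], which lives on [S0]. *)
  have uS : supp_in S0 (uv i).
    have sub v' : deg v' = deg (u i).2 -> supp_in S0 v'.
      move=> eqv; rewrite supp_in_inc; apply/forallP => x; have := forallP aS x.
      rewrite -dega eqv ffunE; case: (deg (u i).2 x) => // n.
      by have -> : deg c x + n.+1 = (deg c x + n)%N.+1 by apply: addnS.
    have /supp_inP s1 := sub _ (Udeg _ (uU i)); have /supp_inP s2 := sub _ (erefl _).
    apply/supp_inP => j; rewrite !ffunE => uvj.
    have [u1|/s1 //] := eqVneq ((u i).1 j) 0.
    have [u2|/s2 //] := eqVneq ((u i).2 j) 0.
    by rewrite u1 u2 subrr eqxx in uvj.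
  have rowi : (red (uv i) <= AS S0)%MS.
    by have := row_sub i (AS S0); rewrite rowK uS.
  have -> : natf (c + (u i).1) - natf b = uv i + (natf (c + (u i).2) - natf b).
    by rewrite !natfD /uv; apply/ffunP => j; rewrite !ffunE; clear; lia.
  rewrite redD; apply/idP/idP => sub; last exact: addmx_sub.
  by rewrite -[red _](addKr (red (uv i))) addmx_sub // eqmx_opp.
(* The rows of [A] and the [#|T|] vectors [P x] span everything mod 2, since an edge [xy] has the
   boundary of [P x + P y - P r]. So [A] has rank at least [m - #|T|], which is at least its number
   of rows. *)
have A_free : row_free A.
  pose P x := proj1_sig (constructive_indefinite_description _ (deg_vtx2 x r)).
  have PE x : deg (P x) = vtx x + vtx r.
    exact: proj2_sig (constructive_indefinite_description _ (deg_vtx2 x r)).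
  pose B : 'M['F_2]_(#|T|, m) := \matrix_j red (P (enum_val j)).
  have PB x : (red (P x) <= B)%MS.
    by have := row_sub (enum_rank x) B; rewrite rowK enum_rankK.
  have full : (1%:M <= A + B)%MS.
    apply/row_subP => i; rewrite row1.
    pose d : {ffun 'I_m -> int} := [ffun j => (i == j)%:R].
    pose q := P (edge i).1 + P (edge i).2 - P r.
    have -> : delta_mx 0 i = red (d - q) + red q.
      rewrite -redD subrK; apply/rowP => j; rewrite !mxE ffunE eqxx eq_sym.
      by case: (i == j).
    have dq : lat setT (d - q).
      split; last by apply/supp_inP => j _; rewrite !in_setT.
      rewrite degB /q degB degD !PE; apply/ffunP => v; rewrite !ffunE (bigD1 i) //= ffunE eqxx.
      rewrite big1 ?addr0 => [|j]; last by rewrite eq_sym ffunE => /negbTE ->; rewrite mul0rn.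
      rewrite /inc; case: ((edge i).1 == v); case: ((edge i).2 == v); case: (r == v); by [].
    apply: addmx_sub_adds; last first.
      rewrite /q redB redD; apply: addmx_sub; last by rewrite eqmx_opp PB.
      by apply: addmx_sub; apply: PB.
    apply: submx_trans (span _ _ dq) _; apply/row_subP => j; rewrite rowK.
    by case: ifP => _; rewrite ?sub0mx //; have := row_sub j A; rewrite rowK.
  have : (m <= \rank A + #|T|)%N.
    rewrite -[X in (X <= _)%N](mxrank1 'F_2 m); apply: leq_trans (mxrankS full) _.
    by apply: leq_trans (mxrank_adds_leqif _ _) _; rewrite leq_add2l rank_leq_row.
  by rewrite -row_leq_rank; move: h_le Uh; rewrite -/k; clear; lia.
have coef S0 w0 : lat S0 w0 -> exists2 l : 'rV['F_2]_k, red w0 = l *m A &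
    forall i, l 0 i != 0 -> supp_in S0 (uv i).
  move=> /span/submxP[l ->]; exists (\row_i (if supp_in S0 (uv i) then l 0 i else 0)).
    apply/rowP => j; rewrite !mxE; apply: eq_bigr => i _; rewrite !mxE.
    by case: ifP => _; rewrite !mxE // mulr0 mul0r.
  by move=> i; rewrite mxE; case: ifP => //; rewrite eqxx.
have lift S0 (l : 'rV['F_2]_k) : (forall i, l 0 i != 0 -> supp_in S0 (uv i)) ->
    exists2 w0, lat S0 w0 & red w0 = l *m A.
  move=> lS; exists (\sum_i (if l 0 i == 0 then 0 else uv i)).
    apply: (big_ind (lat S0)) => [||i _]; [exact: lat0 | exact: latD |].
    by case: eqP => [_|/eqP li]; [exact: lat0 | split=> //; apply: lS].
  rewrite red_sum mulmx_sum_row; apply: eq_bigr => i _; rewrite rowK.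
  have [->|/F2_neq0 ->] := eqVneq (l 0 i) 0; first by rewrite red0 scale0r.
  by rewrite scale1r.
move=> Lw Lw1 Lw2 eqw.
have [l lE lS] := coef _ _ Lw; have [l1 l1E lS1] := coef _ _ Lw1.
have [l2 l2E lS2] := coef _ _ Lw2.
have l12 : l = l1 + l2.
  by apply: (row_free_inj A_free); rewrite /= mulmxDl -lE -l1E -l2E.
(* Deleting from [l1] and [l2] the generators outside the support of [l] preserves [l = l1 + l2],
   and the generators that remain live on [S] as well. *)
pose mu (l' : 'rV['F_2]_k) : 'rV['F_2]_k := \row_i (if l 0 i == 0 then 0 else l' 0 i).
have muS S0 (l' : 'rV['F_2]_k) : (forall i, l' 0 i != 0 -> supp_in S0 (uv i)) ->
    forall i, mu l' 0 i != 0 -> supp_in (S :&: S0) (uv i).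
  move=> lS' i; rewrite mxE; have [_|li] := eqVneq (l 0 i) 0; first by rewrite eqxx.
  move=> /lS'/supp_inP s2; have /supp_inP s1 := lS _ li.
  by apply/supp_inP => j uvj; have [] := s1 _ uvj; have [] := s2 _ uvj; rewrite !inE => -> -> -> ->.
have [w1' L1 E1] := lift _ _ (muS _ _ lS1); have [w2' L2 E2] := lift _ _ (muS _ _ lS2).
exists w1', w2'; split=> //; rewrite E1 E2 -mulmxDl lE; congr (_ *m _).
apply/rowP => i; rewrite !mxE.
have := congr1 (fun l' : 'rV['F_2]_k => l' 0 i) l12; rewrite mxE => li.
by case: eqP => [->|_]; rewrite ?addr0.
Qed.
End Distributivity.
End Lattice.

(** * Odd vertex sets *)

Section OddSets.
Local Open Scope ring_scope.
Variables (T : finType) (e : rel T).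
Hypotheses (e_sym : symmetric e) (e_irr : irreflexive e).
Local Notation m := (nedges e).
Implicit Types (S D X P : {set T}) (w : {ffun 'I_m -> int}) (d : {ffun T -> int}).

Definition reach S d : Prop := exists2 p : {ffun 'I_m -> int}, supp_in S p & deg p = d.

Lemma reach0 S : reach S 0.
Proof. by exists 0; [apply: supp_in0 | apply: deg0]. Qed.

Lemma reachD S d d' : reach S d -> reach S d' -> reach S (d + d').
Proof.
by move=> [p pS <-] [p' pS' <-]; exists (p + p'); [apply: supp_inD | rewrite degD].
Qed.

Lemma reachN S d : reach S d -> reach S (- d).
Proof. by move=> [p pS <-]; exists (- p); [apply: supp_inN | rewrite degN]. Qed.

Lemma reachB S d d' : reach S d -> reach S d' -> reach S (d - d').
Proof. by move=> rd rd'; apply/reachD/reachN. Qed.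

Lemma edge_neq (i : 'I_m) : (edge i).1 != (edge i).2.
Proof. by apply/eqP => eqi; have := edge_e i; rewrite eqi e_irr. Qed.

Lemma reach_edge S x y : induced_rel e S x y -> reach S (vtx x + vtx y).
Proof.
move=> /and3P[exy Sx Sy]; have [i iE] := edge_ex e_sym e_irr exy.
exists [ffun j => (i == j)%:R].
  apply/supp_inP => j; rewrite ffunE; have [<- _|_] := eqVneq i j; last by rewrite eqxx.
  by case: iE => ->.
apply/ffunP => v; rewrite !ffunE (bigD1 i) //= ffunE eqxx big1 => [|j]; last first.
  by rewrite eq_sym ffunE => /negbTE ->; rewrite mul0rn.
by rewrite addr0 /inc natrD; case: iE => -> //=; rewrite addrC.
Qed.

(** Edge vectors with alternating signs telescope along a walk, and the parity of the walk decides
    the sign. *)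
Lemma reach_connect S x y : connect (induced_rel e S) x y ->
  reach S (vtx x - vtx y) \/ reach S (vtx x + vtx y).
Proof.
case/connectP=> s + ->; elim: s x => [|z s IHs] x /=.
  by left; rewrite subrr; apply: reach0.
case/andP=> /reach_edge rxz /IHs[] rz; [right | left].
  have -> : vtx x + vtx (last z s) = vtx x + vtx z - (vtx z - vtx (last z s)).
    by apply/ffunP => v; rewrite !ffunE; clear; lia.
  exact: reachB.
have -> : vtx x - vtx (last z s) = vtx x + vtx z - (vtx z + vtx (last z s)).
  by apply/ffunP => v; rewrite !ffunE; clear; lia.
exact: reachB.
Qed.

Lemma induced_connectedP S x y : induced_connected e S -> x \in S -> y \in S ->
  connect (induced_rel e S) x y.
Proof. by case/andP=> _ /forall_inP H /H /forall_inP; apply. Qed.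

(** If twice [c] were not a boundary on [S], colouring [z] by whether [z - c] is one would be a
    proper 2-colouring, because on a connected set [z - c] or [z + c] is always a boundary. *)
Lemma reach_nonbip S x y : induced_connected e S -> ~~ bipartite_on e S ->
  x \in S -> y \in S -> reach S (vtx x + vtx y).
Proof.
move=> conS nbS.
have reach2 c : c \in S -> reach S (vtx c + vtx c).
  move=> Sc; case: (excluded_middle_informative (reach S (vtx c + vtx c))) => // nr.
  case/negP: nbS; apply/existsP.
  pose chi z : bool := if excluded_middle_informative (reach S (vtx z - vtx c)) then true else false.
  have chiP z : reflect (reach S (vtx z - vtx c)) (chi z).
    by rewrite /chi; case: excluded_middle_informative => H; constructor.
  exists [ffun z => chi z]; apply/forall_inP => a Sa; apply/forall_inP => b Sb.
  apply/implyP => eab; rewrite !ffunE; apply: contra_notN nr => /eqP eqc.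
  have rab : reach S (vtx a + vtx b) by apply: reach_edge; apply/and3P.
  have [ra|na] := chiP a.
    have /chiP rb : chi b by rewrite -eqc; apply/chiP.
    have -> : vtx c + vtx c = vtx a + vtx b - (vtx a - vtx c) - (vtx b - vtx c).
      by apply/ffunP => v; rewrite !ffunE; clear; lia.
    by apply: reachB => //; apply: reachB.
  have nb : ~ reach S (vtx b - vtx c) by move/chiP; rewrite -eqc => /chiP.
  have [//|ra] := reach_connect (induced_connectedP conS Sa Sc).
  have [//|rb] := reach_connect (induced_connectedP conS Sb Sc).
  have -> : vtx c + vtx c = (vtx a + vtx c) + (vtx b + vtx c) - (vtx a + vtx b).
    by apply/ffunP => v; rewrite !ffunE; clear; lia.
  by apply: reachB => //; apply: reachD.
move=> Sx Sy; have [rxy|//] := reach_connect (induced_connectedP conS Sx Sy).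
have -> : vtx x + vtx y = (vtx x - vtx y) + (vtx y + vtx y).
  by rewrite addrA subrK.
by apply: reachD => //; apply: reach2.
Qed.

Lemma sum_inc (i : 'I_m) (f : T -> int) :
  \sum_v f v *+ inc i v = f (edge i).1 + f (edge i).2.
Proof.
have sum1 x : \sum_v f v *+ (x == v) = f x.
  rewrite (bigD1 x) //= eqxx big1 ?addr0 // => v /negbTE.
  by rewrite eq_sym => ->.
by under eq_bigr => v _ do rewrite mulrnDr; rewrite big_split /= !sum1.
Qed.

(** The incidence map against its transpose. A constant weight yields the coordinate sum; the signs
    of a proper 2-colouring make the right side vanish. *)
Lemma sum_deg w (f : T -> int) :
  \sum_v f v * deg w v = \sum_i w i * (f (edge i).1 + f (edge i).2).
Proof.
under [RHS]eq_bigr => i _ do rewrite -sum_inc mulr_sumr.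
rewrite exchange_big; apply: eq_bigr => v _; rewrite ffunE mulr_sumr.
by apply: eq_bigr => i _; rewrite !mulrnAr mulrC.
Qed.

Definition tot w : int := \sum_i w i.

Lemma tot_deg w : tot w *+ 2 = \sum_v deg w v.
Proof.
have := sum_deg w (fun=> 1); under eq_bigr => v _ do rewrite mul1r.
move=> ->; rewrite /tot -mulr_natr mulr_suml; apply: eq_bigr => i _.
by congr (_ * _); rewrite -natrD.
Qed.

Lemma deg0_tot w : deg w = 0 -> tot w = 0.
Proof.
move=> w0; have := tot_deg w; rewrite big1 => [|v _]; last by rewrite w0 ffunE.
by clear; lia.
Qed.

Lemma vtx2_tot w c : deg w = vtx c + vtx c -> tot w = 1.
Proof.
move=> wc; have := tot_deg w; rewrite wc (bigD1 c) //= !ffunE eqxx big1 => [|v]; last first.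
  by rewrite eq_sym !ffunE => /negbTE ->.
by rewrite addr0 -[X in _ = X]mulr2n; clear; lia.
Qed.

(* Summing the coordinates mod 2 distinguishes odd closed walks from lattice vectors. *)
Lemma red_odd w q c : deg w = 0 -> deg q = vtx c + vtx c -> red w <> red q.
Proof.
move=> /deg0_tot w0 /vtx2_tot q1 eqr.
have totE z : (tot z)%:~R = \sum_i red z 0 i.
  rewrite /tot (big_morph (fun x : int => x%:~R : 'F_2) (@intrD _) (erefl _)).
  by apply: eq_bigr => i _; rewrite mxE.
by have := totE w; rewrite eqr -totE w0 q1 => /eqP.
Qed.

Definition restr (A : pred 'I_m) w : {ffun 'I_m -> int} :=
  [ffun i => if A i then w i else 0].

Lemma red_eqP w w' : red w = red w' <-> forall i, (w i)%:~R = (w' i)%:~R :> 'F_2.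
Proof.
split=> [/rowP eqw i|eqw]; first by have := eqw i; rewrite !mxE.
by apply/rowP => i; rewrite !mxE.
Qed.

Lemma supp_in0E S w i : supp_in S w ->
  ~~ (((edge i).1 \in S) && ((edge i).2 \in S)) -> w i = 0.
Proof. by move=> /supp_inP wS; apply: contraNeq => /wS[-> ->]. Qed.

(** No edge joins [X1] and [X2], so cutting [w] down to [X1] keeps the boundary zero; but the part
    kept agrees with [q1] mod 2, against [red_odd]. *)
Lemma split_contra X1 X2 q1 q2 c1 w :
  (forall x y, x \in X1 -> y \in X2 -> x != y /\ ~~ e x y) ->
  supp_in X1 q1 -> supp_in X2 q2 -> deg q1 = vtx c1 + vtx c1 ->
  lat (X1 :|: X2) w -> red w = red q1 + red q2 -> False.
Proof.
move=> sep q1X q2X dq1 [w0 wX] eqw.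
have disj x : x \in X1 -> x \in X2 -> False.
  by move=> X1x X2x; have [/eqP] := sep x x X1x X2x.
pose w1 := restr (fun i => (edge i).1 \in X1) w.
have both i : w i != 0 -> ((edge i).1 \in X1) = ((edge i).2 \in X1).
  move=> wi; have /supp_inP/(_ i wi)[] := wX; rewrite !inE => /orP[a1|a2] /orP[b1|b2].
  - by rewrite a1 b1.
  - by have [_] := sep _ _ a1 b2; rewrite edge_e.
  - by have [_] := sep _ _ b1 a2; rewrite e_sym edge_e.
  - by apply/idP/idP => H; [case: (disj _ H a2) | case: (disj _ H b2)].
have dw1 : deg w1 = 0.
  apply/ffunP => v; rewrite !ffunE.
  have [X1v|nX1v] := boolP (v \in X1).
    transitivity (deg w v); last by rewrite w0 ffunE.
    rewrite ffunE; apply: eq_bigr => i _; rewrite ffunE; case: ifPn => // n1.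
    rewrite mul0rn; have [->|wi] := eqVneq (w i) 0; first by rewrite mul0rn.
    rewrite /inc; case: eqP => [v1|_]; first by rewrite v1 X1v in n1.
    case: eqP => [v2|_]; last by rewrite mulr0n.
    by rewrite both // v2 X1v in n1.
  rewrite big1 // => i _; rewrite ffunE; case: ifPn => [a1|_]; last by rewrite mul0rn.
  have [->|wi] := eqVneq (w i) 0; first by rewrite mul0rn.
  rewrite /inc; case: eqP => [v1|_]; first by rewrite -v1 a1 in nX1v.
  by case: eqP => [v2|_]; [rewrite -v2 -both // a1 in nX1v | rewrite mulr0n].
apply: (red_odd dw1 dq1); apply/red_eqP => i; rewrite ffunE.
have := congr1 (fun r : 'rV['F_2]_m => r 0 i) eqw; rewrite !mxE => wi.
case: ifPn => a1.
  rewrite wi (supp_in0E (i := i) q2X) ?addr0 //; apply/negP => /andP[a2 _].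
  exact: disj a1 a2.
by rewrite (supp_in0E (i := i) q1X) // negb_and a1.
Qed.

Lemma F2_addrr (x : 'F_2) : x + x = 0.
Proof. by case: x => -[|[|k]] lt_k //; apply: val_inj. Qed.

Lemma red_opp w : red (- w) = red w.
Proof.
by rewrite redN; apply/eqP; rewrite eqr_oppLR -addr_eq0; apply/eqP/rowP => i; rewrite !mxE F2_addrr.
Qed.

Lemma red_double w : red (w + w) = 0.
Proof. by rewrite redD -{1}red_opp redN addNr. Qed.

(** A vector on [P] with boundary [c1 - c2] or [c1 + c2] enters with coefficient 2: it balances the
    boundaries and vanishes mod 2. *)
Lemma join_vec S1 S2 P c1 c2 (q1 q2 : {ffun 'I_m -> int}) :
  supp_in S1 q1 -> supp_in S2 q2 -> deg q1 = vtx c1 + vtx c1 ->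
  deg q2 = vtx c2 + vtx c2 -> connect (induced_rel e P) c1 c2 ->
  exists2 w : {ffun 'I_m -> int}, lat (S1 :|: P :|: S2) w & red w = red q1 + red q2.
Proof.
move=> s1 s2 d1 d2 cP.
have s1' : supp_in (S1 :|: P :|: S2) q1.
  by apply: supp_in_sub s1; rewrite -setUA subsetUl.
have s2' : supp_in (S1 :|: P :|: S2) q2 by apply: supp_in_sub s2; rewrite subsetUr.
have sP p : supp_in P p -> supp_in (S1 :|: P :|: S2) (p : {ffun 'I_m -> int}).
  by apply: supp_in_sub; rewrite setUAC subsetUr.
have [[p /sP pP dp]|[p /sP pP dp]] := reach_connect cP.
  exists (q1 - q2 - (p + p)); last by rewrite redB red_double subr0 redD red_opp.
  split; last by apply: supp_inB; [apply: supp_inB | apply: supp_inD].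
  by rewrite !(degB, degD) d1 d2 dp; apply/ffunP => v; rewrite !ffunE; clear; lia.
exists (q1 + q2 - (p + p)); last by rewrite redB red_double subr0 redD.
split; last by apply: supp_inB; apply: supp_inD.
by rewrite degB !degD d1 d2 dp; apply/ffunP => v; rewrite !ffunE; clear; lia.
Qed.

Hypothesis distr : forall S S1 S2 w w1 w2,
  lat S w -> lat S1 w1 -> lat S2 w2 -> red w = red w1 + red w2 ->
  exists w1' w2', [/\ lat (S :&: S1) w1', lat (S :&: S2) w2' &
    red w = red w1' + red w2'].

(* Distributivity rewrites q1 + q2 mod 2 as a + b with a on S1 and P only.  Off P the vector
   a agrees with q1 mod 2, and as P is bipartite, the part of a on P has no boundary at c1:
   so the part of a off P lies in the lattice, against [red_odd]. *)
Lemma three_odd_contra D P S1 S2 c1 c2 :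
  P \subset D -> bipartite_on e P -> connect (induced_rel e P) c1 c2 ->
  c1 \in P -> c2 \in P ->
  S1 :&: D = [set c1] -> S2 :&: D = [set c2] -> S1 :&: S2 \subset P ->
  (forall x y, x \in S1 -> x != c1 -> y \in D -> y != c1 -> ~~ e x y) ->
  reach D (vtx c1 + vtx c1) -> reach S1 (vtx c1 + vtx c1) ->
  reach S2 (vtx c2 + vtx c2) -> False.
Proof.
move=> sPD bipP conP Pc1 Pc2 S1D S2D S12 cross [d1 d1D dd1] [q1 s1 dq1] [q2 s2 dq2].
have [w Lw eqw] := join_vec s1 s2 dq1 dq2 conP.
have L1 : lat (S1 :|: D) (q1 - d1).
  split; first by rewrite degB dq1 dd1 subrr.
  by apply: supp_inB; [apply: supp_in_sub s1 | apply: supp_in_sub d1D];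
     rewrite ?subsetUl ?subsetUr.
(* A doubled vector on [P], invisible mod 2, moves the boundary from twice [c1] to twice [c2]; so
   [d1] and [d2] cancel mod 2 in [eqw12]. *)
have [d2 d2D [dd2 rd]] : exists2 d2 : {ffun 'I_m -> int}, supp_in D d2 &
    deg d2 = vtx c2 + vtx c2 /\ red d2 = red d1.
  have [[p pP dp]|[p pP dp]] := reach_connect conP.
    exists (d1 - (p + p)).
      by apply: supp_inB => //; apply: supp_inD; apply: supp_in_sub pP.
    rewrite redB red_double subr0 degB degD dp dd1; split=> //.
    by apply/ffunP => v; rewrite !ffunE; clear; lia.
  exists (p + p - d1).
    by apply: supp_inB => //; apply: supp_inD; apply: supp_in_sub pP.
  rewrite redB red_double sub0r -redN red_opp degB degD dp dd1; split=> //.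
  by apply/ffunP => v; rewrite !ffunE; clear; lia.
have L2 : lat (S2 :|: D) (q2 - d2).
  split; first by rewrite degB dq2 dd2 subrr.
  by apply: supp_inB; [apply: supp_in_sub s2 | apply: supp_in_sub d2D];
     rewrite ?subsetUl ?subsetUr.
have eqw12 : red w = red (q1 - d1) + red (q2 - d2).
  by rewrite eqw !redB rd addrACA -opprD -(redD d1) red_double subr0.
have [a [b [La Lb eqab]]] := distr Lw L1 L2 eqw12.
have mS1 x : x \in S1 -> x \in D -> x = c1.
  by move=> S1x Dx; apply/set1P; rewrite -S1D inE S1x.
have mS2 x : x \in S2 -> x \in D -> x = c2.
  by move=> S2x Dx; apply/set1P; rewrite -S2D inE S2x.
have mPD x : x \in P -> x \in D by apply: (subsetP sPD).
have m12 x : x \in S1 -> x \in S2 -> x \in P.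
  by move=> S1x S2x; apply: (subsetP S12); rewrite inE S1x.
have {La} [a0 aS] : lat (S1 :|: P) a.
  apply: lat_sub La; apply/subsetP => x; rewrite !inE => /andP[+ /orP[->//|Dx]].
  by case/orP=> [//|S2x]; rewrite (mS2 x) ?Pc2 ?orbT.
have {Lb} [b0 bS] : lat (S2 :|: P) b.
  apply: lat_sub Lb; apply/subsetP => x; rewrite !inE => /andP[+ /orP[->//|Dx]].
  case/orP=> [/orP[S1x|->]|->]; rewrite ?orbT //.
  by rewrite (mS1 x) ?Pc1 ?orbT.
pose inP (i : 'I_m) := ((edge i).1 \in P) && ((edge i).2 \in P).
pose aP := restr inP a; pose aN := restr (predC inP) a.
have aPN : a = aP + aN.
  by apply/ffunP => i; rewrite !ffunE /=; case: (inP i); rewrite ?addr0 ?add0r.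
have noloop (i : 'I_m) c : (edge i).1 = c -> (edge i).2 = c -> False.
  by move=> <- eqc; have := edge_neq i; rewrite eqc eqxx.
(* An edge of [S1 :|: P] not inside [P] lies inside neither [S2] nor [S2 :|: P], so [q2] and [b]
   vanish on it. *)
have raN : red aN = red q1.
  apply/red_eqP => i; rewrite ffunE /=.
  have := congr1 (fun r : 'rV['F_2]_m => r 0 i) eqab; rewrite eqw !mxE => eqi.
  have [iP|niP] /= := boolP (inP i).
    rewrite (supp_in0E (i := i) s1) //; apply/negP => /andP[a1 a2].
    case/andP: iP => /mPD b1 /mPD b2.
    exact: noloop (mS1 _ a1 b1) (mS1 _ a2 b2).
  have [iS|niS] := boolP (((edge i).1 \in S1 :|: P) && ((edge i).2 \in S1 :|: P)); last first.
    rewrite (supp_in0E aS niS) (supp_in0E (i := i) s1) //.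
    by apply: contra niS => /andP[a1 a2]; rewrite !inE a1 a2.
  case/andP: iS; rewrite !inE => i1 i2.
  have inter x : x \in S2 -> (x \in S1) || (x \in P) -> x = c2.
    move=> S2x Hx; apply: mS2 => //; apply: mPD.
    by case/orP: Hx => [S1x|//]; apply: m12.
  have q20 : q2 i = 0.
    apply: (supp_in0E s2); apply/negP => /andP[a1 a2].
    exact: noloop (inter _ a1 i1) (inter _ a2 i2).
  have b_0 : b i = 0.
    apply: (supp_in0E bS); apply: contra niP => /andP[]; rewrite !inE => a1 a2.
    rewrite /inP; apply/andP; split.
      by case/orP: a1 => // a1; case/orP: i1 => // i1; apply: m12.
    by case/orP: a2 => // a2; case/orP: i2 => // i2; apply: m12.
  by rewrite q20 b_0 !addr0 in eqi.
have aP0 v : v != c1 -> deg aP v = 0.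
  move=> vc1; have [Pv|nPv] := boolP (v \in P); last first.
    rewrite ffunE big1 // => i _; rewrite ffunE /inP.
    case: ifP => [/andP[i1 i2]|_]; last by rewrite mul0rn.
    rewrite /inc; case: eqP => [v1|_]; first by rewrite -v1 i1 in nPv.
    by case: eqP => [v2|_]; [rewrite -v2 i2 in nPv | rewrite mulr0n].
  have : deg a v = 0 by rewrite a0 ffunE.
  rewrite aPN degD ffunE [X in _ + X](_ : _ = 0) ?addr0 //.
  rewrite ffunE big1 // => i _; rewrite ffunE /=; case: ifPn => [niP|_]; last by rewrite mul0rn.
  have [->|ai] := eqVneq (a i) 0; first by rewrite mul0rn.
  have /supp_inP/(_ i ai)[] := aS; rewrite !inE => i1 i2.
  have cr x : x \in S1 -> x \notin P -> ~~ e x v.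
    by move=> S1x nPx; apply: cross => //; [apply: contraNneq nPx => -> | apply: mPD].
  rewrite /inc; case: eqP => [v1|_].
    have n2 : (edge i).2 \notin P by apply: contra niP => P2; rewrite /inP v1 Pv.
    rewrite (negbTE n2) orbF in i2.
    by have := cr _ i2 n2; rewrite -v1 e_sym edge_e.
  case: eqP => [v2|_]; last by rewrite mulr0n.
  have n1 : (edge i).1 \notin P by apply: contra niP => P1; rewrite /inP v2 Pv andbT.
  rewrite (negbTE n1) orbF in i1.
  by have := cr _ i1 n1; rewrite -v2 edge_e.
(* Only the boundary at [c1] could be nonzero, and weighing by the signs of a 2-colouring of [P]
   shows that it vanishes. *)
have daP : deg aP = 0.
  apply/ffunP => v; rewrite [RHS]ffunE; have [->|/aP0 //] := eqVneq v c1.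
  case/existsP: bipP => chi /forall_inP chiP.
  have := sum_deg aP (fun x => (-1) ^+ chi x); rewrite (bigD1 c1) //= big1 => [|x /aP0 ->]; last first.
    by rewrite mulr0.
  rewrite big1 => [|i _]; last first.
    rewrite ffunE /inP; case: ifP => [/andP[i1 i2]|_]; last by rewrite mul0r.
    have := implyP (forall_inP (chiP _ i1) _ i2) (edge_e i).
    by case: (chi _) (chi _) => -[] // _; rewrite ?addNr ?subrr ?mulr0.
  by rewrite addr0 => /eqP; rewrite mulf_eq0 signr_eq0 => /eqP.
have daN : deg aN = 0 by move: a0; rewrite aPN degD daP add0r.
exact: (red_odd daN dq1 raN).
Qed.

End OddSets.

(** * Blocks and their gates *)

Section Blocks.
Variables (T : finType) (e : rel T).
Hypotheses (e_sym : symmetric e) (e_irr : irreflexive e).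
Hypothesis G_conn : forall x y : T, connect e x y.
Implicit Types (B D X Y P S : {set T}).

Lemma induced_rel_sym X : symmetric (induced_rel e X).
Proof. by move=> x y; rewrite /induced_rel e_sym; congr andb; rewrite andbC. Qed.

Lemma induced_connect_sym X x y :
  connect (induced_rel e X) x y = connect (induced_rel e X) y x.
Proof. exact/sym_connect_sym/induced_rel_sym. Qed.

Lemma induced_connect_sub X Y x y : X \subset Y ->
  connect (induced_rel e X) x y -> connect (induced_rel e Y) x y.
Proof.
move=> /subsetP sXY; apply: connect_sub => a b /and3P[eab Xa Xb].
by apply: connect1; rewrite /induced_rel eab !sXY.
Qed.

Lemma path_induced_connect X x s : path e x s -> {subset x :: s <= X} ->
  connect (induced_rel e X) x (last x s).
Proof.
elim: s x => [|y s IHs] x //= /andP[exy pys] sX.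
apply: connect_trans (IHs y pys _); last by move=> z ys; apply: sX; rewrite inE ys orbT.
by apply: connect1; rewrite /induced_rel exy !sX ?inE ?eqxx ?orbT.
Qed.

(** In a walk of minimal length, an edge leading more than one position ahead would be a
    shortcut. *)
Lemma geodesic D x y : connect (induced_rel e D) x y -> x \in D ->
  exists s, [/\ path e x s, last x s = y, uniq (x :: s), {subset x :: s <= D} &
    forall a b, a \in x :: s -> b \in x :: s -> e a b ->
      index b (x :: s) <= (index a (x :: s)).+1].
Proof.
move=> cxy Dx.
pose Q n := [exists t : n.-tuple T, path (induced_rel e D) x t && (last x t == y)].
have exQ : exists n, Q n.
  case/connectP: cxy => s ps ys; exists (size s); apply/existsP.
  by exists (in_tuple s); rewrite ps ys eqxx.
case: (ex_minnP exQ) => n /existsP[t /andP[pt /eqP lt]] minn.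
have minS s : path (induced_rel e D) x s -> last x s = y -> n <= size s.
  move=> ps ls; apply: minn; apply/existsP; exists (in_tuple s).
  by rewrite ps ls eqxx.
have [s [ps ls us ss]] : exists s, [/\ path (induced_rel e D) x s, last x s = y,
    uniq (x :: s) & size s = n].
  case/shortenP: pt lt => s ps us sub ls; exists s; split=> //; apply/eqP.
  by rewrite eqn_leq minS // andbT -[X in _ <= X](size_tuple t); case/andP: us => _ us; apply: uniq_leq_size.
have sD : {subset x :: s <= D}.
  move: (ps) Dx; clear; elim: s x => [|z s IHs] x /=.
    by move=> _ Dx u; rewrite inE => /eqP->.
  case/andP=> /and3P[_ _ Dz] /IHs/(_ Dz) sD Dx u; rewrite inE => /orP[/eqP->//|].
  exact: sD.
exists s; split=> //.
  by apply: sub_path ps => a b /and3P[].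
move=> a b ain bin eab; rewrite leqNgt; apply/negP => lt_ab.
set i := index a _ in lt_ab; set j := index b _ in lt_ab.
have lti : i < size (x :: s) by rewrite index_mem.
have ltj : j < size (x :: s) by rewrite index_mem.
have aE : nth x (x :: s) i = a by apply: nth_index.
have bE : nth x (x :: s) j = b by apply: nth_index.
case jE : j => [|k] in lt_ab ltj bE; first by [].
have ks : k < size s by [].
pose s' := take i s ++ drop k s.
have laE : last x (take i s) = a.
  rewrite -aE; case: (i) lt_ab => [|i'] lt_ab /=; first by rewrite take0.
  have lti' : i' < size s by apply: leq_trans ks; move: lt_ab; clear; lia.
  by rewrite (take_nth x) // last_rcons.
have drE : drop k s = b :: drop k.+1 s by rewrite (drop_nth x) // -bE.
have ps' : path (induced_rel e D) x s'.
  move: (ps); rewrite -{1}(cat_take_drop k s) cat_path => /andP[_].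
  rewrite drE /= => /andP[_ pb].
  rewrite cat_path laE drE /= pb andbT take_path //=.
  by rewrite /induced_rel eab !sD.
have ls' : last x s' = y.
  by rewrite last_cat drE /= -ls -{2}(cat_take_drop k s) last_cat drE.
have := minS _ ps' ls'; rewrite size_cat size_takel; last by move: ks lt_ab; clear; lia.
by rewrite size_drop -ss; move: ks lt_ab; clear; lia.
Qed.

(** Edges join only consecutive positions, so the parity of the position is a 2-colouring. *)
Lemma geodesic_bipartite p : uniq p ->
  (forall a b, a \in p -> b \in p -> e a b -> index b p <= (index a p).+1) ->
  bipartite_on e [set x in p].
Proof.
move=> up geo; apply/existsP; exists [ffun x => odd (index x p)].
apply/forall_inP => a; rewrite inE => pa; apply/forall_inP => b; rewrite inE => pb.
apply/implyP => eab; rewrite !ffunE.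
have := geo a b pa pb eab; have := geo b a pb pa; rewrite e_sym => /(_ eab).
have : index a p != index b p.
  apply: contraTneq eab => eqi.
  by rewrite -(nth_index a pa) -(nth_index a pb) eqi e_irr.
by clear; lia.
Qed.

Lemma conn_nocutP B v x y : conn_nocut e B -> x \in B :\ v -> y \in B :\ v ->
  connect (induced_rel e (B :\ v)) x y.
Proof.
case/andP=> conB /forallP/(_ v); rewrite /cut_vertex.
have [Bv /=|nBv _] := boolP (v \in B); last first.
  have -> : B :\ v = B by apply/setDidPl; rewrite disjoint_sym disjoints1.
  exact: induced_connectedP.
move=> /exists_inPn H Bx By; have := H x Bx => /exists_inPn/(_ y By).
by rewrite negbK.
Qed.

Lemma mem_split_last (z b : T) s : z \in b :: s ->
  exists s1 s2, s = s1 ++ s2 /\ last b s1 = z.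
Proof. by case/splitPl=> s1 s2 l1; exists s1, s2. Qed.

(* Adding an ear to a biconnected set keeps it biconnected: deleting v leaves each vertex
   of the ear joined to one of its two ends. *)
Lemma conn_nocut_ear B b b' s : conn_nocut e B -> b \in B -> b' \in B -> b != b' ->
  path e b s -> last b s = b' -> uniq (b :: s) ->
  conn_nocut e (B :|: [set x in b :: s]).
Proof.
move=> ncB Bb Bb' neq_b ps ls us; set B' := _ :|: _.
have sB : B \subset B' by apply: subsetUl.
have sB' z : z \in b :: s -> z \in B' by move=> sz; rewrite !inE -in_cons sz orbT.
have conB : induced_connected e B by case/andP: ncB.
apply/andP; split.
  apply/andP; split; first by apply/set0Pn; exists b; rewrite inE Bb.
  have toB z : z \in B' -> connect (induced_rel e B') b z.
    rewrite !inE -in_cons => /orP[Bz|]; first exact/(induced_connect_sub sB)/induced_connectedP.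
    case/mem_split_last=> s1 [s2 [sE <-]].
    move: ps; rewrite sE cat_path => /andP[ps1 _]; apply: path_induced_connect => // z' sz'.
    by apply: sB'; rewrite sE -cat_cons mem_cat sz'.
  apply/forall_inP => x Bx; apply/forall_inP => y By.
  by apply: connect_trans (toB y By); rewrite induced_connect_sym toB.
apply/forallP => v; rewrite /cut_vertex negb_and; apply/orP; right.
apply/exists_inPn => x Bx; apply/exists_inPn => y By; rewrite negbK.
have sBv : B :\ v \subset B' :\ v by apply: setSD.
suff toB z : z \in B' :\ v ->
    exists2 c, c \in B :\ v & connect (induced_rel e (B' :\ v)) z c.
  have [c Bc xc] := toB x Bx; have [d Bd yd] := toB y By.
  apply: connect_trans xc _; rewrite induced_connect_sym; apply: connect_trans yd _.
  exact/(induced_connect_sub sBv)/conn_nocutP.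
rewrite 2!inE => /andP[zv /setUP[Bz|]]; first by exists z; rewrite ?inE ?zv.
rewrite inE => /mem_split_last[s1 [s2 [sE l1]]].
move: ps ls us; rewrite sE cat_path last_cat -cat_cons cat_uniq => /andP[ps1 ps2] ls /and3P[us1 disj _].
have [vs1|nvs1] := boolP (v \in b :: s1); last first.
  exists b; first by rewrite !inE Bb andbT; apply: contraNneq nvs1 => <-; rewrite inE eqxx.
  rewrite induced_connect_sym -l1; apply: path_induced_connect => // u us1'.
  rewrite in_setD1 sB' ?sE -?cat_cons ?mem_cat ?us1' // andbT.
  by apply: contraNneq nvs1 => <-.
have nvs2 : v \notin s2 by apply: contra disj => vs2; apply/hasP; exists v.
have sub2 : {subset z :: s2 <= B' :\ v}.
  move=> u; rewrite in_setD1 inE => /orP[/eqP->|us2].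
    by rewrite zv sB' // sE -cat_cons mem_cat -l1 mem_last.
  rewrite sB' ?sE -?cat_cons ?mem_cat ?us2 ?orbT // andbT.
  by apply: contraNneq nvs2 => <-.
rewrite l1 in ps2 ls.
exists b'; last by rewrite -ls; apply: path_induced_connect.
by rewrite in_setD1 Bb' andbT -ls; have := sub2 _ (mem_last z s2); rewrite in_setD1 => /andP[].
Qed.

Lemma is_blockP B : is_block e B ->
  conn_nocut e B /\ (forall B', B \subset B' -> conn_nocut e B' -> B' = B).
Proof.
case/andP=> ncB /forallP maxB; split=> // B' sB ncB'.
by apply/eqP; have := maxB B'; rewrite sB ncB'.
Qed.

(** The vertex [g x] is where [x] hangs off [B]: the map is constant on the pieces left when the
    edges inside [B] are deleted. *)
Definition gate B (g : T -> T) : Prop :=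
  [/\ forall x, g x \in B, {in B, forall x, g x = x} &
      forall x y, e x y -> ~~ ((x \in B) && (y \in B)) -> g x = g y].

(** Two vertices of [B] joined by a path avoiding the edges inside [B] would span an ear enlarging
    the block. So each piece left by deleting those edges contains exactly one vertex of [B], the
    value of [g]. *)
Lemma gate_ex B : is_block e B -> exists g, gate B g.
Proof.
move=> blB; have [ncB maxB] := is_blockP blB.
pose R x y := e x y && ~~ ((x \in B) && (y \in B)).
have R_sym : symmetric R by move=> x y; rewrite /R e_sym [(x \in B) && _]andbC.
have R_csym := sym_connect_sym R_sym.
have uniqR b b' : b \in B -> b' \in B -> connect R b b' -> b = b'.
  move=> Bb Bb' /connectP[s0 ps0 ls0]; apply/eqP; apply: contraT => neq_b.
  case/shortenP: ps0 ls0 => s ps us _ ls.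
  have pes : path e b s by apply: sub_path ps => x y /andP[].
  have := maxB _ (subsetUl _ _) (conn_nocut_ear ncB Bb Bb' neq_b pes (esym ls) us).
  move/setP => eqB; case: s ps us ls pes eqB => [|y s] /=.
    by move=> _ _ eqb; rewrite eqb eqxx in neq_b.
  case/andP=> /andP[_ nBy] _ _ _ _ /(_ y); rewrite !inE eqxx !orbT => /esym By.
  by rewrite Bb By in nBy.
have [b0 Bb0] : exists b, b \in B by case/andP: ncB => /andP[/set0Pn].
have exR x : exists2 b, b \in B & connect R x b.
  case/connectP: (G_conn x b0) => s ps ls.
  elim: s x ps ls => [|y s IHs] x /=; first by move=> _ <-; exists b0.
  case/andP=> exy pys ls; have [b Bb yb] := IHs y pys ls.
  have [Bx|nBx] := boolP (x \in B); first by exists x.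
  exists b => //; apply: connect_trans yb; apply: connect1.
  by rewrite /R exy (negbTE nBx).
pose g x := odflt x [pick b in B | connect R x b].
have gP x : g x \in B /\ connect R x (g x).
  rewrite /g; case: pickP => [b /andP[] //|H].
  by have [b Bb xb] := exR x; have := H b; rewrite /= Bb xb.
exists g; split=> [x|x Bx|x y exy nxy]; first by have [] := gP x.
  by have [Bg cg] := gP x; apply/esym/uniqR.
have [Bx cx] := gP x; have [By cy] := gP y; apply: uniqR => //.
rewrite R_csym in cx; apply: connect_trans cx _; apply: connect_trans cy.
by apply: connect1; rewrite /R exy.
Qed.

(** Take [z] in [B2] outside [B]. Deleting [g z] leaves the rest of [B2] connected, while [g] cannot
    change along a walk from [z] that avoids [g z]. So [B] and [B2] share at most [g z], and no edge
    of [B2] lies inside [B]. *)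
Lemma gate_const B B2 g : is_block e B -> is_block e B2 -> B != B2 -> gate B g ->
  {in B2 &, forall x y, g x = g y}.
Proof.
move=> blB blB2 neqB [gB gid gadj]; have [ncB maxB] := is_blockP blB.
have [nc2 max2] := is_blockP blB2.
have [z B2z nBz] : exists2 z, z \in B2 & z \notin B.
  apply/subsetPn; apply: contra neqB => sB2; apply/eqP.
  exact: max2.
have inter y : y \in B -> y \in B2 -> y = g z.
  move=> By B2y; apply/eqP; apply: contraT => neq_y.
  have zc : z != g z by apply: contraNneq nBz => ->.
  have : connect (induced_rel e (B2 :\ g z)) z y.
    by apply: conn_nocutP => //; rewrite in_setD1 ?zc ?neq_y.
  case/connectP=> s ps ys.
  have inv a : path (induced_rel e (B2 :\ g z)) a s -> g a = g z -> g (last a s) = g z.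
    elim: s {ps ys} a => [|b s IHs] a //= /andP[/and3P[eab + _] pbs] ga.
    rewrite in_setD1 => /andP[neq_a _]; apply: IHs => //; rewrite -ga.
    apply/esym/gadj => //; apply: contra neq_a => /andP[Ba _].
    by rewrite -ga gid.
  by rewrite -(gid y By) ys (inv z ps erefl) eqxx in neq_y.
move=> x y B2x B2y.
have : connect (induced_rel e B2) x y.
  by apply: induced_connectedP => //; case/andP: nc2.
case/connectP=> s ps ->; elim: s x {B2x B2y} ps => [|b s IHs] x //= /andP[/and3P[exb B2x B2b] pbs].
rewrite -(IHs b pbs); apply: gadj => //; apply/negP => /andP[Bx Bb].
by move: exb; rewrite (inter x) // (inter b) // e_irr.
Qed.

(** A retraction mapping each edge to an edge or to a point carries the walks of the graph into
    [D]. *)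
Lemma retract_connected D (rho : T -> T) : D != set0 ->
  (forall x, rho x \in D) -> {in D, forall x, rho x = x} ->
  (forall x y, e x y -> rho x = rho y \/ e (rho x) (rho y)) ->
  induced_connected e D.
Proof.
move=> D0 rD rid re; apply/andP; split=> //.
apply/forall_inP => x Dx; apply/forall_inP => y Dy.
rewrite -(rid x Dx) -(rid y Dy); case/connectP: (G_conn x y) => s ps ->.
elim: s x ps {Dx Dy} => [|z s IHs] x //= /andP[exz pzs].
apply: connect_trans (IHs z pzs); case: (re x z exz) => [->//|er].
by apply: connect1; rewrite /induced_rel er !rD.
Qed.

Lemma bipartite_sub X Y : X \subset Y -> bipartite_on e Y -> bipartite_on e X.
Proof.
move=> /subsetP sXY /existsP[chi /forall_inP chiP]; apply/existsP; exists chi.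
apply/forall_inP => x /sXY Yx; apply/forall_inP => y /sXY Yy.
exact: (forall_inP (chiP x Yx)).
Qed.

(** Everything that does not hang at [c] is collapsed to [c]; an edge inside [B] then shrinks to
    [c], and any other edge is kept or collapsed as a whole. *)
Lemma gate_retract B g c x y : gate B g -> e x y ->
  (if g x == c then x else c) = (if g y == c then y else c) \/
  e (if g x == c then x else c) (if g y == c then y else c).
Proof.
case=> gB gid gadj exy; have [|nB] := boolP ((x \in B) && (y \in B)).
  case/andP=> Bx By; rewrite !gid //.
  by left; case: eqP => [->|_]; case: eqP => [->|_].
by rewrite (gadj x y) //; case: eqP => _; [right | left].
Qed.

Local Notation m := (nedges e).
Hypothesis distr : forall S S1 S2 (w w1 w2 : {ffun 'I_m -> int}),
  lat S w -> lat S1 w1 -> lat S2 w2 -> red w = (red w1 + red w2)%R ->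
  exists w1' w2', [/\ lat (S :&: S1) w1', lat (S :&: S2) w2' &
    red w = (red w1' + red w2')%R].

Lemma set1_mem X Y c : X :&: Y = [set c] -> c \in X /\ c \in Y.
Proof. by move=> /setP/(_ c); rewrite !inE eqxx => /andP. Qed.

(** A geodesic of [D] from [c1] to [c2] serves as the bipartite connection [P] of
    [three_odd_contra]. *)
Lemma three_nonbip_contra D S1 S2 c1 c2 :
  induced_connected e D -> induced_connected e S1 -> induced_connected e S2 ->
  ~~ bipartite_on e D -> ~~ bipartite_on e S1 -> ~~ bipartite_on e S2 ->
  S1 :&: D = [set c1] -> S2 :&: D = [set c2] -> S1 :&: S2 \subset D ->
  (forall x y, x \in S1 -> x != c1 -> y \in D -> y != c1 -> ~~ e x y) -> False.
Proof.
move=> cD cS1 cS2 nD nS1 nS2 S1D S2D S12 cross.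
have [S1c1 Dc1] := set1_mem S1D; have [S2c2 Dc2] := set1_mem S2D.
have [s [ps ls us sD geo]] := geodesic (induced_connectedP cD Dc1 Dc2) Dc1.
apply: (three_odd_contra e_sym e_irr distr (D := D) (P := [set x in c1 :: s])
  (S1 := S1) (S2 := S2) (c1 := c1) (c2 := c2)) => //.
- by apply/subsetP => x; rewrite inE; apply: sD.
- exact: (@geodesic_bipartite (c1 :: s) us geo).
- by rewrite -ls; apply: path_induced_connect => // x sx; rewrite inE.
- by rewrite inE mem_head.
- by rewrite inE -ls mem_last.
- apply/subsetP => x /setIP[S1x S2x].
  have : x \in S1 :&: D by rewrite inE S1x (subsetP S12) // inE S1x.
  by rewrite S1D => /set1P ->; rewrite inE mem_head.
- exact: reach_nonbip.
- exact: reach_nonbip.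
- exact: reach_nonbip.
Qed.

(** If the gates differed, the fibres of [g] over them would be two odd sets attached to the odd
    block [B] at different vertices, which [three_nonbip_contra] excludes. *)
Lemma gate_nonbip_eq B B' B'' g x' x'' :
  is_block e B -> is_block e B' -> is_block e B'' ->
  ~~ bipartite_on e B -> ~~ bipartite_on e B' -> ~~ bipartite_on e B'' ->
  B != B' -> B != B'' -> gate B g -> x' \in B' -> x'' \in B'' -> g x' = g x''.
Proof.
move=> bl bl' bl'' nb nb' nb'' neq' neq'' gg Bx' Bx''; apply/eqP; apply: contraT => neqg.
have [gB gid gadj] := gg.
pose fib c := [set x | g x == c].
have fibB c : c \in B -> fib c :&: B = [set c].
  move=> Bc; apply/setP => x; rewrite !inE; have [Bx|nBx] := boolP (x \in B).
    by rewrite gid // andbT.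
  by rewrite andbF; apply/esym; apply: contraNF nBx => /eqP->.
have confib c : c \in B -> induced_connected e (fib c).
  move=> Bc; apply: (@retract_connected _ (fun x => if g x == c then x else c)).
  - by apply/set0Pn; exists c; rewrite inE gid.
  - by move=> x; rewrite inE; case: ifP => // _; rewrite gid.
  - by move=> x; rewrite inE => ->.
  - by move=> x y; apply: gate_retract gg.
have nbfib x B0 : is_block e B0 -> B != B0 -> ~~ bipartite_on e B0 -> x \in B0 ->
    ~~ bipartite_on e (fib (g x)).
  move=> bl0 neq0 nb0 B0x; apply: contra nb0; apply: bipartite_sub.
  by apply/subsetP => y B0y; rewrite inE (gate_const bl bl0 neq0 gg B0y B0x).
case: (@three_nonbip_contra B (fib (g x')) (fib (g x'')) (g x') (g x'')) => //.
- by case: (is_blockP bl) => /andP[].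
- exact: confib.
- exact: confib.
- exact: nbfib nb' Bx'.
- exact: nbfib nb'' Bx''.
- exact: fibB.
- exact: fibB.
- apply/subsetP => y; rewrite !inE => /andP[/eqP y1 /eqP y2].
  by rewrite -y1 -y2 eqxx in neqg.
- move=> x y; rewrite inE => /eqP gx xc By yc; apply/negP => exy.
  have nBx : x \notin B by apply: contra xc => Bx; rewrite -gx gid.
  by case/eqP: yc; rewrite -gx (gadj x y) ?(negbTE nBx) // gid.
Qed.

(** * The region between two blocks *)

Section TwoBlocks.
Variables (B1 B2 : {set T}) (g1 g2 : T -> T) (c1 c2 : T).
Hypotheses (bl1 : is_block e B1) (bl2 : is_block e B2).
Hypotheses (gg1 : gate B1 g1) (gg2 : gate B2 g2).
Hypotheses (g1B2 : {in B2, forall x, g1 x = c1}) (g2B1 : {in B1, forall x, g2 x = c2}).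

Let D := [set x | (g1 x == c1) && (g2 x == c2)].

Lemma between_gates : c1 \in B1 /\ c2 \in B2.
Proof.
have [[gB1 _ _] [gB2 _ _]] := (gg1, gg2).
have [[/andP[/andP[/set0Pn[x1 Bx1] _] _] _] [/andP[/andP[/set0Pn[x2 Bx2] _] _] _]] :=
  (is_blockP bl1, is_blockP bl2).
by split; [rewrite -(g1B2 Bx2) | rewrite -(g2B1 Bx1)].
Qed.

Lemma between_mem : c1 \in D /\ c2 \in D.
Proof.
have [Bc1 Bc2] := between_gates; have [[_ gid1 _] [_ gid2 _]] := (gg1, gg2).
by rewrite !inE (gid1 _ Bc1) (g2B1 Bc1) (g1B2 Bc2) (gid2 _ Bc2) !eqxx.
Qed.

(** Collapsing to [c1] and then to [c2] retracts the graph onto [D]: the second collapse moves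
    vertices only to [c2], which itself hangs at [c1]. *)
Lemma between_connected : induced_connected e D.
Proof.
have [Dc1 Dc2] := between_mem.
pose r1 x := if g1 x == c1 then x else c1; pose r2 x := if g2 x == c2 then x else c2.
apply: (@retract_connected _ (fun x => r2 (r1 x))).
- by apply/set0Pn; exists c1.
- move=> x; have r1x : g1 (r1 x) == c1.
    by rewrite /r1; case: ifP => // _; move: Dc1; rewrite inE => /andP[].
  rewrite /r2; case: ifP => [r2x|_]; first by rewrite inE r1x.
  exact: Dc2.
- by move=> x; rewrite inE /r1 /r2 => /andP[-> ->].
- move=> x y exy; have [r1xy|er1] := gate_retract c1 gg1 exy.
    by left; rewrite /r1 r1xy.
  exact: gate_retract gg2 er1.
Qed.

Lemma between_inter : [/\ B1 :&: D = [set c1], B2 :&: D = [set c2] & B1 :&: B2 \subset D].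
Proof.
have [Bc1 Bc2] := between_gates; have [[_ gid1 _] [_ gid2 _]] := (gg1, gg2).
have [Dc1 Dc2] := between_mem.
split.
- apply/setP => x; rewrite in_setI in_set1; have [->|xc] := eqVneq x c1; first by rewrite Bc1.
  by apply/negP => /andP[Bx]; rewrite inE gid1 // (negbTE xc).
- apply/setP => x; rewrite in_setI in_set1; have [->|xc] := eqVneq x c2; first by rewrite Bc2.
  by apply/negP => /andP[Bx]; rewrite inE gid2 // (negbTE xc) andbF.
- by apply/subsetP => x; rewrite !inE => /andP[Bx1 Bx2]; rewrite g1B2 // g2B1 // !eqxx.
Qed.

Lemma between_cross x y : x \in B1 -> x != c1 -> g1 y = c1 -> y != c1 -> ~~ e x y.
Proof.
have [_ gid1 gadj1] := gg1; move=> Bx xc gy yc; apply/negP => exy.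
have nBy : y \notin B1 by apply: contra yc => By; rewrite -gy gid1.
by case/eqP: xc; rewrite -gy -(gadj1 x y) ?(negbTE nBy) ?andbF // gid1.
Qed.
End TwoBlocks.

(** By [gate_nonbip_eq] the third block hangs off [B1] where [B2] does and off [B2] where [B1] does.
    It lies in the region between them, which is thus an odd set with [B1] and [B2] attached. *)
Lemma three_blocks_contra B1 B2 B3 :
  is_block e B1 -> is_block e B2 -> is_block e B3 ->
  ~~ bipartite_on e B1 -> ~~ bipartite_on e B2 -> ~~ bipartite_on e B3 ->
  B1 != B2 -> B1 != B3 -> B2 != B3 -> False.
Proof.
move=> bl1 bl2 bl3 nb1 nb2 nb3 neq12 neq13 neq23.
have [g1 gg1] := gate_ex bl1; have [g2 gg2] := gate_ex bl2.
have [x1 Bx1] : exists x, x \in B1 by case: (is_blockP bl1) => /andP[/andP[/set0Pn]].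
have [x2 Bx2] : exists x, x \in B2 by case: (is_blockP bl2) => /andP[/andP[/set0Pn]].
have neq21 : B2 != B1 by rewrite eq_sym.
have g1B2 : {in B2, forall x, g1 x = g1 x2} by move=> x Bx; apply: (gate_const bl1 bl2).
have g2B1 : {in B1, forall x, g2 x = g2 x1} by move=> x Bx; apply: (gate_const bl2 bl1).
have [S1D S2D S12] := between_inter bl1 bl2 gg1 gg2 g1B2 g2B1.
apply: (three_nonbip_contra _ _ _ _ nb1 nb2 S1D S2D S12).
- exact: (between_connected bl1 bl2 gg1 gg2 g1B2 g2B1).
- by case: (is_blockP bl1) => /andP[].
- by case: (is_blockP bl2) => /andP[].
- apply: (contra _ nb3); apply: bipartite_sub; apply/subsetP => x Bx; rewrite inE.
  rewrite (gate_nonbip_eq bl1 bl3 bl2 nb1 nb3 nb2 neq13 neq12 gg1 Bx Bx2) eqxx.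
  by rewrite (gate_nonbip_eq bl2 bl3 bl1 nb2 nb3 nb1 neq23 neq21 gg2 Bx Bx1) eqxx.
- move=> x y Bx xc; rewrite inE => /andP[/eqP gy _].
  exact: (between_cross gg1).
Qed.

Lemma nth_induced_connect X p x0 i j : i <= j -> j < size p ->
  (forall k, k.+1 < size p -> e (nth x0 p k) (nth x0 p k.+1)) ->
  (forall k, i <= k <= j -> nth x0 p k \in X) ->
  connect (induced_rel e X) (nth x0 p i) (nth x0 p j).
Proof.
move=> le_ij + pe; elim: j le_ij => [|j IHj].
  by rewrite leqn0 => /eqP->.
rewrite leq_eqVlt => /orP[/eqP<- //|le_ij] ltj pX.
apply: (connect_trans (IHj _ _ _)) => //; first exact: ltnW.
  by move=> k /andP[ik kj]; apply: pX; rewrite ik leqW.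
by apply: connect1; rewrite /induced_rel pe // !pX // ?leqnn ?leqnSn ?andbT // ltnW.
Qed.

(** The path is a geodesic between the gates. If a block contained two of its edges, deleting the
    vertex [v] after the first edge would leave a detour through the block, and the common part of
    the two connections falls apart at [v]. *)
Lemma two_blocks_contiguous B1 B2 :
  is_block e B1 -> is_block e B2 -> ~~ bipartite_on e B1 -> ~~ bipartite_on e B2 ->
  B1 != B2 -> contiguous e B1 B2.
Proof.
move=> bl1 bl2 nb1 nb2 neq12; have neq21 : B2 != B1 by rewrite eq_sym.
have [g1 gg1] := gate_ex bl1; have [g2 gg2] := gate_ex bl2.
have [x1 Bx1] : exists x, x \in B1 by case: (is_blockP bl1) => /andP[/andP[/set0Pn]].
have [x2 Bx2] : exists x, x \in B2 by case: (is_blockP bl2) => /andP[/andP[/set0Pn]].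
set c1 := g1 x2; set c2 := g2 x1.
have g1B2 : {in B2, forall x, g1 x = c1} by move=> x Bx; apply: (gate_const bl1 bl2).
have g2B1 : {in B1, forall x, g2 x = c2} by move=> x Bx; apply: (gate_const bl2 bl1).
have [S1D S2D S12] := between_inter bl1 bl2 gg1 gg2 g1B2 g2B1.
have cD := between_connected bl1 bl2 gg1 gg2 g1B2 g2B1.
set D := [set x | _] in S1D S2D S12 cD.
have [Bc1 Dc1] := set1_mem S1D; have [Bc2 Dc2] := set1_mem S2D.
have [s [ps ls us sD geo]] := geodesic (induced_connectedP cD Dc1 Dc2) Dc1.
exists c1, s; split=> //; first by rewrite ls.
set p := c1 :: s in us sD geo *.
suff wl i j B : i < j -> j < size s -> is_block e B ->
    edge_in e B (nth c1 p i) (nth c1 p i.+1) ->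
    edge_in e B (nth c1 p j) (nth c1 p j.+1) -> False.
  move=> i j lti ltj neq_ij B blB; apply/negP => /andP[ei ej].
  case: (ltngtP i j) neq_ij => // [lt_ij|lt_ji] _.
    exact: wl lt_ij ltj blB ei ej.
  exact: wl lt_ji lti blB ej ei.
move=> lt_ij ltj blB /and3P[_ Bi Bi1] /and3P[_ _ Bj1].
have lt_size k : k <= j.+1 -> k < size p by rewrite /= ltnS => /leq_trans; apply.
pose v := nth c1 p i.+1.
have idx k : k <= size s -> index (nth c1 p k) p = k.
  by move=> ks; apply: index_uniq.
have pe k : k.+1 < size p -> e (nth c1 p k) (nth c1 p k.+1).
  by move=> ks; apply: (pathP c1 ps).
have idx2 : index c2 p = size s by rewrite -ls (last_nth c1) idx.
pose P := [set x in p].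
pose Q := (P :|: B) :\ v.
have PD x : x \in P -> x \in D by rewrite inE; apply: sD.
have vQ k : k <= size s -> k != i.+1 -> nth c1 p k \in Q.
  move=> ks neq_k; rewrite !inE -in_cons mem_nth //= andbT.
  by apply: contra neq_k => /eqP eqk; rewrite -(idx k) // eqk idx //; apply: leq_trans lt_ij (ltnW ltj).
have conP : connect (induced_rel e P) c1 c2.
  by rewrite -ls; apply: path_induced_connect => // x sx; rewrite inE.
have conQ : connect (induced_rel e Q) c1 c2.
  apply: (connect_trans (y := nth c1 p i)).
    apply: (@nth_induced_connect _ p c1 0 i) => //; first by apply/lt_size/leqW/ltnW.
    by move=> k /andP[_ ki]; apply: vQ; move: ki lt_ij ltj; clear; lia.
  apply: (connect_trans (y := nth c1 p j.+1)).
    have sBQ : B :\ v \subset Q by apply: setSD; apply: subsetUr.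
    apply: (induced_connect_sub sBQ); apply: conn_nocutP; first by case: (is_blockP blB).
      by rewrite in_setD1 Bi andbT; have := vQ i; rewrite in_setD1 => /(_ _ _)/andP[] //;
        move: lt_ij ltj; clear; lia.
    by rewrite in_setD1 Bj1 andbT; have := vQ j.+1; rewrite in_setD1 => /(_ _ _)/andP[] //;
      move: lt_ij ltj; clear; lia.
  have -> : c2 = nth c1 p (size s) by rewrite -ls (last_nth c1).
  by apply: nth_induced_connect => // k /andP[jk ks]; apply: vQ; move: jk ks lt_ij; clear; lia.
have [q1 s1 dq1] : reach e B1 (vtx c1 + vtx c1)%R.
  by apply: reach_nonbip => //; case: (is_blockP bl1) => /andP[].
have [q2 s2 dq2] : reach e B2 (vtx c2 + vtx c2)%R.
  by apply: reach_nonbip => //; case: (is_blockP bl2) => /andP[].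
have [w Lw ew] := join_vec e_sym e_irr s1 s2 dq1 dq2 conP.
have [w' Lw' ew'] := join_vec e_sym e_irr s1 s2 dq1 dq2 conQ.
(* Distributivity with the empty set as second summand represents the common class of [w] and [w']
   on the intersection of their vertex sets. *)
have [|a [b [La Lb eqab]]] := distr Lw Lw' (lat0 e set0).
  by rewrite red0 addr0 ew ew'.
(* The two sides of the geodesic at [v], whose position [i.+1] is left out of both pieces of the
   path. *)
pose X1 := B1 :|: [set x in p | index x p <= i].
pose X2 := B2 :|: [set x in p | i.+1 < index x p].
have sub : (B1 :|: P :|: B2) :&: (B1 :|: Q :|: B2) \subset X1 :|: X2.
  have inB1 x : x \in B1 -> x \in X1 :|: X2 by move=> Bx; rewrite 2!in_setU Bx.
  have inB2 x : x \in B2 -> x \in X1 :|: X2.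
    by move=> Bx; rewrite in_setU [x \in X2]in_setU Bx orbT.
  apply/subsetP => x /setIP[/setUP[/setUP[/inB1//|Px]|/inB2//]].
  case/setUP=> [/setUP[/inB1//|]|/inB2//].
  rewrite in_setD1 => /andP[xv _]; have px : x \in p by rewrite inE in Px.
  have : index x p != i.+1 by apply: contra xv => /eqP eqx; rewrite /v -eqx nth_index.
  have [le_i _|lt_i neq_i] := leqP (index x p) i.
    by rewrite 2!in_setU [x \in [set _ in _ | _]]inE px le_i orbT.
  rewrite in_setU [x \in X2]in_setU [X in _ || (_ || X)]inE px /=.
  by rewrite ltn_neqAle eq_sym neq_i lt_i !orbT.
have Lab : lat (X1 :|: X2) (a + b)%R.
  apply: latD; first exact: lat_sub La.
  by apply: lat_sub Lb; rewrite setI0 sub0set.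
(* The sides are separated: the geodesic has no chord over [v], and [B1] and [B2] touch the region
   between them only at the gates. *)
apply: (@split_contra _ _ e_sym X1 X2 q1 q2 c1 (a + b)%R _ _ _ dq1 Lab).
- have [[_ gid1 _] [_ gid2 _]] := (gg1, gg2).
  have idx1 : index c1 p = 0 by rewrite /p /= eqxx.
  have PD1 y : y \in p -> g1 y = c1 /\ g2 y = c2.
    by move=> /sD; rewrite inE => /andP[/eqP-> /eqP->].
  have c1B2 : c1 \notin B2.
    apply/negP => B2c1; have : c1 \in B2 :&: D by rewrite inE B2c1.
    by rewrite S2D => /set1P eqc; move: idx2 lt_ij ltj; rewrite -eqc idx1; clear; lia.
  have sepP x y : x \in p -> index x p <= i -> y \in p -> i.+1 < index y p ->
      x != y /\ ~~ e x y.
    move=> px ix py iy; split; first by apply: contraTneq ix => ->; move: iy; clear; lia.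
    by apply/negP => exy; have := geo x y px py exy; move: ix iy; clear; lia.
  have p1 : c1 \in p by apply: mem_head.
  have p2 : c2 \in p by rewrite -ls; apply: mem_last.
  have sepB x y : x \in p -> index x p <= i -> y \in X2 -> x != y /\ ~~ e x y.
    move=> px ix; rewrite in_setU inE => /orP[B2y|/andP[py iy]]; last exact: sepP.
    have [yc|yc] := eqVneq y c2; first by rewrite yc; apply: sepP => //; rewrite idx2; move: lt_ij ltj; clear; lia.
    have [_ gx] := PD1 x px; have xc : x != c2 by apply: contraTneq ix => ->; rewrite idx2; move: lt_ij ltj; clear; lia.
    split; last by rewrite e_sym; apply: (between_cross gg2 B2y yc gx xc).
    by apply: contra yc => /eqP xy; rewrite -gx xy gid2.
  move=> x y; rewrite in_setU inE => /orP[B1x|/andP[px ix]]; last exact: sepB.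
  have [->|xc] := eqVneq x c1; first by apply: sepB; rewrite ?idx1.
  rewrite in_setU inE => Xy.
  have [gy yc] : g1 y = c1 /\ y != c1.
    case/orP: Xy => [B2y|/andP[py iy]].
      by split; [apply: g1B2 | apply: contraNneq c1B2 => <-].
    by split; [have [] := PD1 y py | apply: contraTneq iy => ->; rewrite idx1].
  split; last exact: (between_cross gg1 B1x xc gy yc).
  by apply: contra xc => /eqP xy; rewrite -gy -xy gid1.
- by apply: supp_in_sub s1; apply: subsetUl.
- by apply: supp_in_sub s2; apply: subsetUl.
- by rewrite redD -eqab ew.
Qed.

End Blocks.

(** * Counting the non-bipartite blocks *)

Theorem theorem4p2 (K : fieldType) (T : finType) (e : rel T)
  (e_sym : symmetric e) (e_irr : irreflexive e)
  (G_conn : forall x y : T, connect e x y)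
  (G_ci : complete_intersection e K) :
  let NB := nonbip_blocks e in
  (* exactly one of (1), (2), (3): they are mutually exclusive by counting *)
  [/\ (#|NB| = 0%N) \/ (#|NB| = 1%N) \/
      (exists B1 B2 : {set T}, [/\ NB = [set B1; B2], B1 != B2 & contiguous e B1 B2]),
      ~ ((#|NB| = 0%N) /\ (#|NB| = 1%N)),
      ~ ((#|NB| = 0%N) /\ (exists B1 B2 : {set T}, [/\ NB = [set B1; B2], B1 != B2 & contiguous e B1 B2]))
    & ~ ((#|NB| = 1%N) /\ (exists B1 B2 : {set T}, [/\ NB = [set B1; B2], B1 != B2 & contiguous e B1 B2]))].
Proof.
move=> NB; split.
- case: (posnP #|NB|) => [|NB_gt0]; first by left.
  case: (eqVneq #|NB| 1) => [|NB1]; first by right; left.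
  right; right; have [B1 [B2 [NB1' NB2 neqB]]] : exists B1 B2, [/\ B1 \in NB, B2 \in NB & B1 != B2].
    by apply/card_gt1P; case: #|NB| NB_gt0 NB1 => [|[]].
  have [/andP[bl1 nb1] /andP[bl2 nb2]] : (is_block e B1 && ~~ bipartite_on e B1) /\
      (is_block e B2 && ~~ bipartite_on e B2).
    by move: NB1' NB2; rewrite !inE.
  (* An odd block makes the whole graph odd, so [reach_nonbip] on all vertices supplies the rank
     hypothesis of [lat_distr]. *)
  have nbT : ~~ bipartite_on e [set: T] by apply: contra nb1; apply: bipartite_sub; apply: subsetT.
  have [r Br] : exists x, x \in B1 by case: (is_blockP bl1) => /andP[/andP[/set0Pn]].
  have conT : induced_connected e [set: T].
    apply: (@retract_connected _ _ G_conn _ id) => //.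
      by apply/set0Pn; exists r.
    by move=> x y; right.
  have vtx2 x y : exists p : {ffun 'I_(nedges e) -> int}, deg p = (vtx x + vtx y)%R.
    by have [p _ dp] := reach_nonbip e_sym e_irr conT nbT (in_setT x) (in_setT y); exists p.
  have distr := lat_distr vtx2 G_ci r.
  exists B1, B2; split=> //; last exact: (two_blocks_contiguous e_sym e_irr G_conn distr).
  apply/setP => B3; rewrite !inE; apply/idP/idP => [/andP[bl3 nb3]|/orP[]/eqP->]; last 2 first.
  + by rewrite bl1 nb1.
  + by rewrite bl2 nb2.
  apply: contraT; rewrite negb_or eq_sym [B3 == B2]eq_sym => /andP[neq13 neq23].
  by case: (three_blocks_contra e_sym e_irr G_conn distr bl1 bl2 bl3 nb1 nb2 nb3).
- by case=> ->.
- by case=> NB0 [B1 [B2 [NBE neqB _]]]; move: NB0; rewrite NBE cards2 neqB.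
- by case=> NB1 [B1 [B2 [NBE neqB _]]]; move: NB1; rewrite NBE cards2 neqB.
Qed.
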